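(* Let $M$ be a loopless matroid of rank $n$ on the set $\{0,\dots,N\}$, let $\Sigma_0(M)$ be its Bergman fan, let $\mathcal{F}^\bullet(\Sigma_0(M))$ be the tropical cohomology algebra of this fan, and let $OS_0^\bullet(M)$ be the projective Orlik-Solomon algebra of $M$ over $\mathbb{Z}$. Then there is a canonical isomorphism of graded algebras $$\mathcal{F}^\bullet(\Sigma_0(M))\cong OS_0^\bullet(M),$$ namely the one induced by the canonical identification of $W_0$ with the dual group $\mathrm{Hom}(V_0,\mathbb{Z})$.
   Context: Groups: $V$ and $W$ are free abelian groups of rank $N+1$ with bases $e_0,\dots,e_N$ and $f_0,\dots,f_N$, regarded as dual to each other via these dual bases. $V_0:=V/\langle e_0+\dots+e_N\rangle$, and $W_0\subset W$ is the subgroup generated by all differences $f_i-f_j$. The duality of $V$ and $W$ identifies $W_0$ with $V_0^*=\mathrm{Hom}(V_0,\mathbb{Z})$. Bergman fan: for a flat $J=\{j_1,\dots,j_m\}$ of $M$ put $e_J:=e_{j_1}+\dots+e_{j_m}$. $\Sigma_0(M)$ is the simplicial fan in $V_0\otimes\mathbb{R}$ whose rays are spanned by the images of $e_J$ for all proper flats $J$ (nonempty and different from the whole ground set), and whose $k$-dimensional cones are spanned by the images of $e_{J_1},\dots,e_{J_k}$ for flags $J_1\subsetneq\dots\subsetneq J_k$ of proper flats (the empty flag gives the cone $\{0\}$). Tropical homology and cohomology: for a cone $\sigma\in\Sigma_0(M)$, $\langle\sigma\rangle_{\mathbb{Z}}$ is the lattice of points of $V_0$ in the linear span of $\sigma$.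 $\mathcal{F}_k(\Sigma_0(M))\subset\wedge^k V_0$ is the subgroup generated by all $v_1\wedge\dots\wedge v_k$ with $v_1,\dots,v_k\in\langle\sigma\rangle_{\mathbb{Z}}$ for some cone $\sigma\in\Sigma_0(M)$ (so $\mathcal{F}_0=\mathbb{Z}$). The cohomology is the dual group $\mathcal{F}^k(\Sigma_0(M)):=\mathrm{Hom}(\mathcal{F}_k(\Sigma_0(M)),\mathbb{Z})$, which, via restriction of forms, is the quotient of $\wedge^k V_0^*$ by the annihilator $(\mathcal{F}_k(\Sigma_0(M)))^\perp$, with respect to the standard determinantal pairing between $\wedge^k V_0^*$ and $\wedge^k V_0$. The product on $\mathcal{F}^\bullet=\bigoplus_k\mathcal{F}^k$ is the one induced by the wedge product on $\wedge^\bullet V_0^*$ (the annihilators form an ideal). Projective Orlik-Solomon algebra: for an ordered subset $I=\{i_0,\dots,i_k\}$ of $\{0,\dots,N\}$ put $F_I:=f_{i_0}\wedge\dots\wedge f_{i_k}$ and $\partial F_I:=\sum_{s=0}^k(-1)^s f_{i_0}\wedge\dots\hat f_{i_s}\dots\wedge f_{i_k}$ (the hat denotes omission). The Orlik-Solomon ideal $\mathcal{I}\subset\wedge^\bullet W$ is the ideal of the exterior algebra over $\mathbb{Z}$ generated by all $\partial F_I$ with $I$ a dependent subset of $M$. Put $\mathcal{I}_0:=\mathcal{I}\cap\wedge^\bullet W_0$ and $OS_0^\bullet(M):=\wedge^\bullet W_0/\mathcal{I}_0^\bullet$. *)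

(* Defs.v *)
From HB Require Import structures.
From mathcomp Require Import all_boot all_order all_algebra.
From mathcomp Require Import boolp reals.
From mathcomp Require classical_sets.
From mathcomp Require Import ring lra.

Set Implicit Arguments.
Unset Strict Implicit.
Unset Printing Implicit Defensive.

Import GRing.Theory.
Import VectorInternalTheory.

Local Open Scope ring_scope.
Local Open Scope quotient_scope.

Inductive generated (U : zmodType) (G : U -> Prop) : U -> Prop :=
| generated0 : generated G 0
| generatedD x g : generated G x -> G g -> generated G (x + g)
| generatedB x g : generated G x -> G g -> generated G (x - g).

Definition gensub (U : zmodType) (G : U -> Prop) : {pred U} :=
  fun x => `[< generated G x >].

Lemma gensubP (U : zmodType) (G : U -> Prop) (x : U) :
  reflect (generated G x) (x \in gensub G).
Proof. exact: asboolP. Qed.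

Section GeneratedTheory.
Context {U : zmodType}.
Implicit Types (G : U -> Prop) (x y : U).

Lemma generated_add G x y : generated G x -> generated G y -> generated G (x + y).
Proof.
move=> Gx; elim=> [|z g _ IH Gg|z g _ IH Gg]; first by rewrite addr0.
- by rewrite addrA; apply: generatedD.
- by rewrite addrA; apply: generatedB.
Qed.

Lemma generated_opp G x : generated G x -> generated G (- x).
Proof.
elim=> [|z g _ IH Gg|z g _ IH Gg]; first by rewrite oppr0; apply: generated0.
- by rewrite opprD; apply: generatedB.
- by rewrite opprB addrC; apply: generatedD.
Qed.

Lemma generated_mem G x : G x -> generated G x.
Proof. by move=> Gx; rewrite -[x]add0r; apply: generatedD (generated0 _) Gx. Qed.

Lemma generated_min G (P : U -> Prop) :
  P 0 -> (forall x y, P x -> P y -> P (x + y)) -> (forall x, P x -> P (- x)) ->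
  (forall g, G g -> P g) -> forall x, generated G x -> P x.
Proof.
move=> P0 PD PN PG x; elim=> [|z g _ IH Gg|z g _ IH Gg] //.
- by apply: PD => //; apply: PG.
- by apply: PD => //; apply: PN; apply: PG.
Qed.

Lemma gensub_zmod_closed G : zmod_closed (gensub G).
Proof.
split; first by apply/gensubP; apply: generated0.
move=> x y /gensubP Gx /gensubP Gy; apply/gensubP.
exact: generated_add (generated_opp Gy).
Qed.

HB.instance Definition _ G :=
  GRing.isZmodClosed.Build U (gensub G) (gensub_zmod_closed G).
End GeneratedTheory.

HB.mixin Record isTwoSidedIdeal (A : nzRingType) (S : {pred A}) := {
  ideal_mull : forall a x : A, x \in S -> a * x \in S;
  ideal_mulr : forall a x : A, x \in S -> x * a \in S
}.

#[short(type="twoSidedIdeal")]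
HB.structure Definition TwoSidedIdeal (A : nzRingType) :=
  {S of isTwoSidedIdeal A S & GRing.ZmodClosed A S}.

Definition ring_quot (A : nzRingType) (I : twoSidedIdeal A) : Type := Quotient.quot I.

Section RingQuot.
Context {A : nzRingType} {I : twoSidedIdeal A}.
Notation Q := (ring_quot I).

HB.instance Definition _ := GRing.Zmodule.copy Q (Quotient.quot I).

Definition rq_class (x : A) : Q := \pi_(Quotient.quot I) x.
Definition rq_mul (x y : Q) : Q :=
  rq_class (repr (x : Quotient.quot I) * repr (y : Quotient.quot I)).

Lemma rq_classP (x y : A) : rq_class x = rq_class y <-> x - y \in I.
Proof. by rewrite Quotient.idealrBE; split => [/eqP|/eqP]. Qed.

Lemma rq_classK (x : Q) : rq_class (repr (x : Quotient.quot I)) = x.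
Proof. exact: reprK. Qed.

Lemma rq_classD : {morph rq_class : x y / x + y}.
Proof. by move=> x y; rewrite /rq_class !piE. Qed.

Lemma rq_classM (x y : A) : rq_class (x * y) = rq_mul (rq_class x) (rq_class y).
Proof.
apply: (proj2 (rq_classP _ _)); set x' := repr _; set y' := repr _.
have Ix : x - x' \in I by apply: (proj1 (rq_classP _ _)); rewrite rq_classK.
have Iy : y - y' \in I by apply: (proj1 (rq_classP _ _)); rewrite rq_classK.
have -> : x * y - x' * y' = (x - x') * y + x' * (y - y').
  by rewrite mulrBl mulrBr addrA subrK.
by apply: rpredD; [apply: ideal_mulr | apply: ideal_mull].
Qed.

Lemma rq_mulA : associative rq_mul.
Proof.
move=> x y z; rewrite -(rq_classK x) -(rq_classK y) -(rq_classK z).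
by rewrite -!rq_classM mulrA.
Qed.

Lemma rq_mul1 : left_id (rq_class 1) rq_mul.
Proof. by move=> x; rewrite -(rq_classK x) -rq_classM mul1r. Qed.

Lemma rq_1mul : right_id (rq_class 1) rq_mul.
Proof. by move=> x; rewrite -(rq_classK x) -rq_classM mulr1. Qed.

Lemma rq_mulDl : left_distributive rq_mul +%R.
Proof.
move=> x y z; rewrite -(rq_classK x) -(rq_classK y) -(rq_classK z).
by rewrite -rq_classD -!rq_classM -rq_classD mulrDl.
Qed.

Lemma rq_mulDr : right_distributive rq_mul +%R.
Proof.
move=> x y z; rewrite -(rq_classK x) -(rq_classK y) -(rq_classK z).
by rewrite -rq_classD -!rq_classM -rq_classD mulrDr.
Qed.

HB.instance Definition _ := GRing.Zmodule_isPzRing.Build Q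
  rq_mulA rq_mul1 rq_1mul rq_mulDl rq_mulDr.

Lemma rq_class_zmod_morphism : zmod_morphism rq_class.
Proof. by move=> x y; rewrite /rq_class !piE. Qed.

Lemma rq_class_monoid_morphism : monoid_morphism rq_class.
Proof. by split=> // x y; rewrite rq_classM. Qed.

HB.instance Definition _ :=
  GRing.isZmodMorphism.Build A Q rq_class rq_class_zmod_morphism.
HB.instance Definition _ :=
  GRing.isMonoidMorphism.Build A Q rq_class rq_class_monoid_morphism.
End RingQuot.

(* The coordinates [v2r] of [V] fix a basis b_0, ..., b_(d-1) of [V]; the
   function [x : ext V] stands for the sum over all A of x(A) b_A, where b_A
   is the wedge product of the b_i, i in A, taken in increasing order
   ([ext_monomialE]); [ext_vec] is the inclusion of [V] in degree 1. *)
Definition ext (R : comNzRingType) (V : vectType R) : Type :=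
  {ffun {set 'I_(dim V)} -> R}.

Section ExteriorAlgebra.
Context {R : comNzRingType} {V : vectType R}.
Notation d := (dim V).
Implicit Types (A B C S T : {set 'I_d}) (x y z : ext V).

HB.instance Definition _ := GRing.Lmodule.copy (ext V) {ffun {set 'I_d} -> R^o}.

Definition inversions A B : nat :=
  (\sum_(a in A) \sum_(b in B) (b < a))%N.

(* b_A b_B = \sum_S ext_coef A B S *: b_S *)
Definition ext_coef A B S : R :=
  if [disjoint A & B] && (A :|: B == S) then (-1) ^+ inversions A B else 0.

Definition ext_mul x y : ext V :=
  [ffun S => \sum_A \sum_B x A * y B * ext_coef A B S].

Definition ext_one : ext V := [ffun S => (S == set0)%:R].

Lemma inversionsUl A B C :
  [disjoint A & B] -> inversions (A :|: B) C = (inversions A C + inversions B C)%N.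
Proof. by move=> dAB; rewrite /inversions -bigU //; apply: eq_bigl => a; rewrite !inE. Qed.

Lemma inversionsUr A B C :
  [disjoint B & C] -> inversions A (B :|: C) = (inversions A B + inversions A C)%N.
Proof.
move=> dBC; rewrite /inversions -big_split; apply: eq_bigr => a _ /=.
by rewrite -bigU //; apply: eq_bigl => b; rewrite !inE.
Qed.

Lemma ext_coefA A B C S :
  \sum_T ext_coef B C T * ext_coef A T S = \sum_T ext_coef A B T * ext_coef T C S.
Proof.
rewrite (bigD1 (B :|: C)) //= [RHS](bigD1 (A :|: B)) //=.
rewrite [X in _ + X]big1 => [|T neT]; last first.
  by rewrite /ext_coef [_ == T]eq_sym (negPf neT) andbF mul0r.
rewrite [X in _ = _ + X]big1 => [|T neT]; last first.
  by rewrite /ext_coef [_ == T]eq_sym (negPf neT) andbF mul0r.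
rewrite !addr0 /ext_coef !eqxx !andbT setUA.
have disjUr : [disjoint A & B :|: C] = [disjoint A & B] && [disjoint A & C].
  by rewrite -!setI_eq0 setIUr setU_eq0.
have disjUl : [disjoint A :|: B & C] = [disjoint A & C] && [disjoint B & C].
  by rewrite -!setI_eq0 setIUl setU_eq0.
rewrite disjUr disjUl.
case dBC: [disjoint B & C]; last by rewrite andbF /= mul0r mulr0.
case dAB: [disjoint A & B]; last by rewrite /= mul0r mulr0.
case dAC: [disjoint A & C] => /=; last by rewrite !mulr0.
case: eqP => _; last by rewrite !mulr0.
by rewrite inversionsUl // inversionsUr // -!exprD; congr (_ ^+ _); rewrite addnC addnA.
Qed.

Lemma ext_mulA : associative ext_mul.
Proof.
move=> x y z; apply/ffunP => S; rewrite !ffunE.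
transitivity (\sum_A \sum_B \sum_C x A * y B * z C *
    \sum_T ext_coef B C T * ext_coef A T S).
  apply: eq_bigr => A _.
  under eq_bigr => T _ do rewrite ffunE mulr_sumr mulr_suml.
  rewrite exchange_big; apply: eq_bigr => B _ /=.
  under eq_bigr => T _ do rewrite mulr_sumr mulr_suml.
  rewrite exchange_big; apply: eq_bigr => C _ /=.
  by rewrite mulr_sumr; apply: eq_bigr => T _; rewrite !mulrA.
transitivity (\sum_A \sum_B \sum_C x A * y B * z C *
    \sum_T ext_coef A B T * ext_coef T C S).
  apply: eq_bigr => A _; apply: eq_bigr => B _; apply: eq_bigr => C _.
  by rewrite ext_coefA.
transitivity (\sum_T \sum_C \sum_A \sum_B
    x A * y B * ext_coef A B T * z C * ext_coef T C S); last first.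
  apply: eq_bigr => T _; apply: eq_bigr => C _; rewrite ffunE !mulr_suml.
  by apply: eq_bigr => A _; rewrite !mulr_suml.
under [RHS]eq_bigr => T _ do rewrite exchange_big /=.
rewrite [RHS]exchange_big; apply: eq_bigr => A _ /=.
under [RHS]eq_bigr => T _ do rewrite exchange_big /=.
rewrite [RHS]exchange_big; apply: eq_bigr => B _ /=.
rewrite [RHS]exchange_big; apply: eq_bigr => C _ /=.
rewrite mulr_sumr; apply: eq_bigr => T _.
by rewrite !mulrA; congr (_ * _); rewrite mulrAC.
Qed.

Lemma ext_coef0l B S : ext_coef set0 B S = (B == S)%:R.
Proof.
by rewrite /ext_coef -setI_eq0 set0I eqxx set0U /inversions big_set0; case: eqP.
Qed.

Lemma ext_coef0r A S : ext_coef A set0 S = (A == S)%:R.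
Proof.
rewrite /ext_coef -setI_eq0 setI0 eqxx setU0 /inversions big1 => [|a _].
  by case: eqP.
by rewrite big_set0.
Qed.

Lemma ext_mul1 : left_id ext_one ext_mul.
Proof.
move=> x; apply/ffunP => S; rewrite ffunE (bigD1 set0) //=.
rewrite [X in _ + X]big1 => [|A /negPf neA]; last first.
  by apply: big1 => B _; rewrite ffunE neA !mul0r.
rewrite addr0 (bigD1 S) //= big1 => [|B /negPf neB].
  by rewrite addr0 ffunE eqxx mul1r ext_coef0l eqxx mulr1.
by rewrite ext_coef0l neB mulr0.
Qed.

Lemma ext_1mul : right_id ext_one ext_mul.
Proof.
move=> x; apply/ffunP => S; rewrite ffunE exchange_big /= (bigD1 set0) //=.
rewrite [X in _ + X]big1 => [|A /negPf neA]; last first.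
  by apply: big1 => B _; rewrite ffunE neA mulr0 mul0r.
rewrite addr0 (bigD1 S) //= big1 => [|B /negPf neB].
  by rewrite addr0 ffunE eqxx mulr1 ext_coef0r eqxx mulr1.
by rewrite ext_coef0r neB mulr0.
Qed.

Lemma ext_mulDl : left_distributive ext_mul +%R.
Proof.
move=> x y z; apply/ffunP => S; rewrite !ffunE -big_split; apply: eq_bigr => A _.
by rewrite -big_split; apply: eq_bigr => B _; rewrite ffunE !mulrDl.
Qed.

Lemma ext_mulDr : right_distributive ext_mul +%R.
Proof.
move=> x y z; apply/ffunP => S; rewrite !ffunE -big_split; apply: eq_bigr => A _.
by rewrite -big_split; apply: eq_bigr => B _; rewrite ffunE mulrDr mulrDl.
Qed.

Lemma ext_one_neq0 : ext_one != 0.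
Proof.
by apply/eqP => /ffunP /(_ set0) /eqP; rewrite !ffunE eqxx oner_eq0.
Qed.

HB.instance Definition _ := GRing.Zmodule_isNzRing.Build (ext V)
  ext_mulA ext_mul1 ext_1mul ext_mulDl ext_mulDr ext_one_neq0.

Lemma ext_scaleAl (a : R) x y : a *: (x * y) = a *: x * y.
Proof.
apply/ffunP => S; rewrite !ffunE scaler_sumr; apply: eq_bigr => A _.
by rewrite scaler_sumr; apply: eq_bigr => B _; rewrite ffunE /GRing.scale /= !mulrA.
Qed.

HB.instance Definition _ := GRing.Lmodule_isLalgebra.Build R (ext V) ext_scaleAl.

Lemma ext_scaleAr (a : R) x y : a *: (x * y) = x * (a *: y).
Proof.
apply/ffunP => S; rewrite !ffunE scaler_sumr; apply: eq_bigr => A _.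
rewrite scaler_sumr; apply: eq_bigr => B _; rewrite ffunE /GRing.scale /=.
by rewrite !mulrA [a * x A]mulrC.
Qed.

HB.instance Definition _ := GRing.Lalgebra_isAlgebra.Build R (ext V) ext_scaleAr.

Definition ext_monomial S : ext V := [ffun T => (T == S)%:R].

Definition ext_vec (v : V) : ext V :=
  \sum_(i < d) v2r v 0 i *: ext_monomial [set i].

Definition wedge (vs : seq V) : ext V := \prod_(v <- vs) ext_vec v.

Definition homogeneous (k : nat) (x : ext V) : Prop :=
  forall S, x S != 0 -> #|S| = k.

Definition basis_seq S : seq V := [seq r2v (delta_mx 0 i) | i <- enum S].

Lemma ext_monomialM A B S :
  (ext_monomial A * ext_monomial B : ext V) S = ext_coef A B S.
Proof.
rewrite ffunE (bigD1 A) //= (bigD1 B) //= !ffunE !eqxx !mul1r.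
rewrite big1 => [|T /negPf neT]; last by rewrite !ffunE neT mulr0 mul0r.
rewrite big1 ?addr0 // => T /negPf neT; apply: big1 => U _.
by rewrite !ffunE neT !mul0r.
Qed.

Lemma ext_vecE i : ext_vec (r2v (delta_mx 0 i)) = ext_monomial [set i] :> ext V.
Proof.
rewrite /ext_vec r2vK (bigD1 i) //= big1 => [|j /negPf ne].
  by rewrite mxE !eqxx scale1r addr0.
by rewrite mxE ne andbF scale0r.
Qed.

Lemma ext_monomialE S : ext_monomial S = wedge (basis_seq S) :> ext V.
Proof.
have ltn_tr : transitive (fun i j : 'I_d => i < j)%N.
  by move=> j i k; apply: ltn_trans.
rewrite -{1}[S]set_enum /wedge /basis_seq big_map.
have : sorted (fun i j : 'I_d => i < j)%N (enum S).
  have -> : enum S = [seq i <- enum 'I_d | i \in S] by rewrite [enum 'I_d]enumT.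
  apply: sorted_filter => [j i k|]; first exact: ltn_trans.
  have := iota_ltn_sorted 0 d; rewrite -val_enum_ord sorted_map; exact: id.
elim: (enum S) => [_|i s IH /= pis]; rewrite ?big_nil ?big_cons.
  by apply/ffunP => T; rewrite !ffunE; congr ((_ == _)%:R); apply/setP => i; rewrite !inE.
rewrite -IH ?(path_sorted pis) // ext_vecE; apply/ffunP => T.
have lt_i j : j \in s -> (i < j)%N.
  by move: pis; rewrite (path_sortedE ltn_tr) => /andP[/allP ltis _] /ltis.
rewrite ext_monomialM ffunE /ext_coef set_cons disjoints1 inE.
case: (boolP (i \in s)) => [/lt_i|_ /=]; first by rewrite ltnn.
rewrite eq_sym; case: eqP => // _.
rewrite /inversions big_set1 big1 // => j; rewrite inE => /lt_i.
by rewrite ltnNge => /negPf; rewrite leq_eqVlt => /norP[_ /negPf ->].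
Qed.

Lemma ext_vec_sq (v : V) : ext_vec v * ext_vec v = 0.
Proof.
have mono2 (i j : 'I_d) : (i < j)%N -> ext_monomial [set j] * ext_monomial [set i]
    = - (ext_monomial [set i] * ext_monomial [set j]) :> ext V.
  move=> ij; apply/ffunP => T; rewrite [RHS]ffunE !ext_monomialM /ext_coef.
  rewrite disjoint_sym setUC; case: ifP => _; last by rewrite oppr0.
  by rewrite /inversions !big_set1 ij ltnNge ltnW // expr1 opprK.
have mono1 (i : 'I_d) : ext_monomial [set i] * ext_monomial [set i] = 0 :> ext V.
  apply/ffunP => T; rewrite ext_monomialM /ext_coef [RHS]ffunE.
  by rewrite disjoints1 !inE eqxx.
rewrite /ext_vec mulr_suml.
under eq_bigr => i _ do rewrite mulr_sumr.
rewrite pair_bigA /= (bigID (fun p : 'I_d * 'I_d => (p.1 < p.2)%N)) /=.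
rewrite [X in _ + X](bigID (fun p : 'I_d * 'I_d => (p.2 < p.1)%N)) /=.
rewrite [X in _ + (_ + X)]big1 => [|[i j] /= /andP[]]; last first.
  rewrite -!leqNgt => ji ij; have -> : i = j by apply/val_inj/anti_leq; rewrite ij ji.
  by rewrite -scalerAl -scalerAr mono1 !scaler0.
rewrite addr0 [X in _ + X](reindex_inj (h := fun p => (p.2, p.1))) /=; last first.
  by move=> [? ?] [? ?] [-> ->].
rewrite [X in _ + X](eq_bigl (fun p : 'I_d * 'I_d => (p.1 < p.2)%N)); last first.
  by move=> [i j] /=; rewrite -leqNgt; case: (ltngtP i j).
rewrite -big_split big1 // => -[i j] /= ij.
by rewrite -!scalerAl -!scalerAr (mono2 _ _ ij) !scalerA scalerN [v2r v 0 j * _]mulrC subrr.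
Qed.
End ExteriorAlgebra.

Section DeterminantalPairing.
Context {R : comNzRingType} {V : vectType R}.

Definition det_pairing (us : seq 'Hom(V, R^o)) (vs : seq V) : R :=
  if size us == size vs then
    \det (\matrix_(a < size us, b < size us) (us`_a vs`_b : R))
  else 0.

(* The bilinear extension of
     <u_1 /\ ... /\ u_k, v_1 /\ ... /\ v_k> = det (u_a (v_b)),
   exterior powers of different degrees being orthogonal. *)
Definition pairing (om : ext 'Hom(V, R^o)) (x : ext V) : R :=
  \sum_S \sum_T om S * x T * det_pairing (basis_seq S) (basis_seq T).

Lemma pairingBr om x y : pairing om (x - y) = pairing om x - pairing om y.
Proof.
rewrite /pairing -sumrB; apply: eq_bigr => S _; rewrite -sumrB.
by apply: eq_bigr => T _; rewrite !ffunE mulrBr mulrBl.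
Qed.
End DeterminantalPairing.

Record matroid (T : finType) := Matroid {
  indep : pred {set T};
  indep_set0 : indep set0;
  indep_sub : forall A B : {set T}, A \subset B -> indep B -> indep A;
  indep_exchange : forall A B : {set T}, indep A -> indep B ->
    (#|A| < #|B|)%N -> exists2 x, x \in B :\: A & indep (x |: A)
}.

Section MatroidTheory.
Context {T : finType} (M : matroid T).

Definition mrank (A : {set T}) : nat :=
  \max_(B : {set T} | indep M B && (B \subset A)) #|B|.

Definition loopless : Prop := forall x, indep M [set x].

Definition flat (F : {set T}) : bool :=
  [forall x, (x \notin F) ==> (mrank F < mrank (x |: F))%N].

Definition proper_flat (F : {set T}) : bool :=
  [&& flat F, F != set0 & F != setT].

Definition flag (Js : seq {set T}) : bool :=
  all proper_flat Js && sorted (fun A B : {set T} => A \proper B) Js.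
End MatroidTheory.

Definition lattV (N : nat) : Type := 'rV[int]_N.+1.
Definition lattW (N : nat) : Type := 'rV[int]_N.+1.
HB.instance Definition _ N := Vector.copy (lattV N) 'rV[int]_N.+1.
HB.instance Definition _ N := Vector.copy (lattW N) 'rV[int]_N.+1.

Definition vecE N (i : 'I_N.+1) : lattV N := delta_mx 0 i.
Definition vecF N (i : 'I_N.+1) : lattW N := delta_mx 0 i.

Definition dualpair N (w : lattW N) (v : lattV N) : int := \sum_i w 0 i * v 0 i.

Definition latt_diag N : {pred lattV N} :=
  gensub (fun v => v = \sum_i vecE i).
HB.instance Definition _ N := GRing.ZmodClosed.on (@latt_diag N).

Definition lattV0 (N : nat) : Type := Quotient.quot (@latt_diag N).
HB.instance Definition _ N :=
  GRing.Zmodule.copy (lattV0 N) (Quotient.quot (@latt_diag N)).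

Section LattV0.
Context {N : nat}.
Implicit Types (v : lattV N) (x y : lattV0 N).

Definition classV0 v : lattV0 N := \pi_(Quotient.quot (@latt_diag N)) v.
Definition reprV0 x : lattV N := repr (x : Quotient.quot (@latt_diag N)).

Lemma reprV0K : cancel reprV0 classV0. Proof. exact: reprK. Qed.

Lemma classV0P v v' : classV0 v = classV0 v' <-> v - v' \in @latt_diag N.
Proof. by rewrite Quotient.idealrBE; split => [/eqP|/eqP]. Qed.

Lemma classV0_zmod_morphism : zmod_morphism classV0.
Proof. by move=> v v'; rewrite /classV0 !piE. Qed.
HB.instance Definition _ :=
  GRing.isZmodMorphism.Build (lattV N) (lattV0 N) classV0 classV0_zmod_morphism.

Definition lattV0_scale (a : int) x : lattV0 N := x *~ a.

Lemma lattV0_scaleA a b x :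
  lattV0_scale a (lattV0_scale b x) = lattV0_scale (a * b) x.
Proof. by rewrite /lattV0_scale mulrzA mulrzAC. Qed.
Lemma lattV0_scale1 : left_id 1 lattV0_scale.
Proof. by move=> x; rewrite /lattV0_scale mulr1z. Qed.
Lemma lattV0_scaleDr : right_distributive lattV0_scale +%R.
Proof. by move=> a x y; rewrite /lattV0_scale mulrzDl. Qed.
Lemma lattV0_scaleDl x : {morph lattV0_scale^~ x : a b / a + b}.
Proof. by move=> a b; rewrite /lattV0_scale mulrzDr. Qed.

HB.instance Definition _ := GRing.Zmodule_isLmodule.Build int (lattV0 N)
  lattV0_scaleA lattV0_scale1 lattV0_scaleDr lattV0_scaleDl.

Lemma latt_diagP v :
  reflect (forall i, v 0 i = v 0 ord0) (v \in @latt_diag N).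
Proof.
have allE i : (\sum_i vecE i : lattV N) 0 i = 1.
  rewrite summxE (bigD1 i) //= big1 => [|j /negPf ne]; rewrite !mxE eqxx /=.
    by rewrite eqxx addr0.
  by rewrite eq_sym ne.
apply: (iffP (gensubP _ _)).
  elim=> [|v1 w _ IH ->|v1 w _ IH ->] i; first by rewrite !mxE.
    by rewrite !mxE IH !allE.
  by rewrite !mxE IH !allE.
move=> cst; have {cst}-> : v = (\sum_i vecE i) *~ v 0 ord0.
  by apply/rowP => i; rewrite -scaler_int mxE allE cst mulr1 intz.
by apply/gensubP; rewrite rpredMz //; apply/gensubP; apply: generated_mem.
Qed.

(* the coordinates with respect to the basis given by the images of e_1, ..., e_N *)
Definition lattV0_coord x : 'rV[int]_N :=
  \row_j (reprV0 x 0 (lift ord0 j) - reprV0 x 0 ord0).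

Lemma lattV0_coordE v :
  lattV0_coord (classV0 v) = \row_j (v 0 (lift ord0 j) - v 0 ord0).
Proof.
have /classV0P/latt_diagP eqv : classV0 (reprV0 (classV0 v)) = classV0 v.
  exact: reprV0K.
apply/rowP => j; rewrite !mxE; have := eqv (lift ord0 j); rewrite !mxE => E.
by lra.
Qed.

Lemma lattV0_coord_linear : linear lattV0_coord.
Proof.
move=> a x y; rewrite -(reprV0K x) -(reprV0K y).
have -> : a *: classV0 (reprV0 x) + classV0 (reprV0 y)
    = classV0 (a *: reprV0 x + reprV0 y).
  by rewrite raddfD -[in RHS](intz a) scaler_int raddfMz.
by rewrite !lattV0_coordE; apply/rowP => j; rewrite !mxE; ring.
Qed.

Lemma lattV0_coord_bij : bijective lattV0_coord.
Proof.
exists (fun r : 'rV[int]_N => classV0 (\row_i oapp (r 0) 0 (unlift ord0 i))) => [x|r].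
  rewrite -{2}(reprV0K x); apply/classV0P/latt_diagP => i; rewrite !mxE unlift_none /=.
  by case: unliftP => [j|] -> /=; rewrite ?mxE; ring.
by rewrite lattV0_coordE; apply/rowP => j; rewrite !mxE liftK unlift_none /= subr0.
Qed.

Lemma lattV0_vector : Vector.axiom N (lattV0 N).
Proof. by exists lattV0_coord; [apply: lattV0_coord_linear | apply: lattV0_coord_bij]. Qed.

HB.instance Definition _ := Lmodule_hasFinDim.Build int (lattV0 N) lattV0_vector.
End LattV0.

Definition dualV0 (N : nat) : vectType int := 'Hom(lattV0 N, int^o).

Definition in_lattW0 N : {pred lattW N} :=
  gensub (fun w => exists i j, w = vecF i - vecF j).
HB.instance Definition _ N := GRing.ZmodClosed.on (@in_lattW0 N).

Definition lattW0 (N : nat) : Type := {w : lattW N | w \in @in_lattW0 N}.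
HB.instance Definition _ N := SubChoice.on (lattW0 N).
HB.instance Definition _ N := [SubChoice_isSubZmodule of lattW0 N by <:].

(* the identification of W_0 with Hom(V_0, Z); see [dualW0E] *)
Definition dualW0 N (w : lattW0 N) : dualV0 N :=
  linfun (fun x : lattV0 N => dualpair (val w) (reprV0 x) : int^o).

Lemma sum_lattW0 N (w : lattW0 N) : \sum_i val w 0 i = 0.
Proof.
pose S (u : 'rV[int]_N.+1) := \sum_i u 0 i.
have SF k : S (vecF k) = 1.
  by rewrite /S (bigD1 k) //= big1 => [|l /negPf ne]; rewrite !mxE ?eqxx ?ne.
have SB u v : S (u - v) = S u - S v.
  by rewrite /S -sumrB; apply: eq_bigr => l _; rewrite !mxE.
have SD u v : S (u + v) = S u + S v.
  by rewrite /S -big_split; apply: eq_bigr => l _; rewrite !mxE.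
have /gensubP := valP w; rewrite -/(S _).
elim=> [|v _ _ IH [i [j ->]]|v _ _ IH [i [j ->]]].
- by rewrite /S big1 // => i _; rewrite mxE.
- by rewrite SD SB IH !SF.
- by rewrite !SB IH !SF.
Qed.

Lemma dualW0E N (w : lattW0 N) (v : lattV N) :
  dualW0 w (classV0 v) = dualpair (val w) v.
Proof.
have pairE u : dualpair (val w) (reprV0 (classV0 u)) = dualpair (val w) u.
  have /classV0P/latt_diagP eqv : classV0 (reprV0 (classV0 u)) = classV0 u.
    exact: reprV0K.
  apply/eqP; rewrite -subr_eq0 -sumrB; apply/eqP.
  transitivity (\sum_i val w 0 i * (reprV0 (classV0 u) - u) 0 ord0).
    by apply: eq_bigr => i _; rewrite -(eqv i) !mxE mulrBr.
  by rewrite -mulr_suml sum_lattW0 mul0r.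
rewrite /dualW0.
have lin : linear (fun x : lattV0 N => dualpair (val w) (reprV0 x) : int^o).
  move=> a x y; rewrite -{1}(reprV0K x) -{1}(reprV0K y).
  have -> : a *: classV0 (reprV0 x) + classV0 (reprV0 y)
      = classV0 (a *: reprV0 x + reprV0 y).
    by rewrite raddfD -[in RHS](intz a) scaler_int raddfMz.
  rewrite pairE /dualpair scaler_sumr -big_split; apply: eq_bigr => i _ /=.
  by rewrite !mxE /GRing.scale /=; ring.
pose f : {linear lattV0 N -> int^o} := HB.pack
  (fun x : lattV0 N => dualpair (val w) (reprV0 x) : int^o)
  (GRing.isLinear.Build _ _ _ _ _ lin).
by rewrite (lfunE f) /= pairE.
Qed.

(* the exterior algebra of W_0, as a subring of that of W *)
Definition in_extW0 N : {pred ext (lattW N)} :=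
  gensub (fun x => exists ws : seq (lattW0 N), x = wedge (map val ws)).
HB.instance Definition _ N := GRing.ZmodClosed.on (@in_extW0 N).

Lemma in_extW0_subring N : subring_closed (@in_extW0 N).
Proof.
split; first by apply/gensubP; apply: generated_mem; exists [::]; rewrite /wedge big_nil.
  by move=> x y Wx Wy; rewrite rpredB.
move=> x y /gensubP Wx /gensubP Wy; apply/gensubP; move: x Wx.
apply: generated_min => [|x1 x2 H1 H2|x1 H1|_ [ws ->]].
- by rewrite mul0r; apply: generated0.
- by rewrite mulrDl; apply: generated_add.
- by rewrite mulNr; apply: generated_opp.
move: y Wy; apply: generated_min => [|y1 y2 H1 H2|y1 H1|_ [us ->]].
- by rewrite mulr0; apply: generated0.
- by rewrite mulrDr; apply: generated_add.
- by rewrite mulrN; apply: generated_opp.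
by apply: generated_mem; exists (ws ++ us); rewrite /wedge map_cat big_cat.
Qed.
HB.instance Definition _ N :=
  GRing.isSubringClosed.Build (ext (lattW N)) (@in_extW0 N) (@in_extW0_subring N).

Definition extW0 (N : nat) : Type := {x : ext (lattW N) | x \in @in_extW0 N}.
HB.instance Definition _ N := SubChoice.on (extW0 N).
HB.instance Definition _ N := [SubChoice_isSubNzRing of extW0 N by <:].

Lemma wedgeW0_subproof N (ws : seq (lattW0 N)) :
  wedge (map val ws) \in @in_extW0 N.
Proof. by apply/gensubP; apply: generated_mem; exists ws. Qed.

Definition wedgeW0 N (ws : seq (lattW0 N)) : extW0 N :=
  Sub (wedge (map val ws)) (wedgeW0_subproof ws).

Definition OS_boundary N (s : seq 'I_N.+1) : ext (lattW N) :=
  \sum_(k < size s)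
    (-1) ^+ k * wedge [seq vecF i | i <- take k s ++ drop k.+1 s].

Section OrlikSolomon.
Context {N : nat} (M : matroid 'I_N.+1).

(* The boundaries are taken over all orderings [s] of the dependent sets;
   reordering only affects their signs. *)
Definition OS_ideal : {pred ext (lattW N)} :=
  gensub (fun x => exists a s b,
    [/\ uniq s, ~~ indep M [set i in s] & x = a * OS_boundary s * b]).
HB.instance Definition _ := GRing.ZmodClosed.on OS_ideal.

Lemma OS_ideal_mull (a x : ext (lattW N)) : x \in OS_ideal -> a * x \in OS_ideal.
Proof.
move=> /gensubP Ix; apply/gensubP; move: x Ix.
apply: generated_min => [|x1 x2 H1 H2|x1 H1|_ [c [s [b [us ds ->]]]]].
- by rewrite mulr0; apply: generated0.
- by rewrite mulrDr; apply: generated_add.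
- by rewrite mulrN; apply: generated_opp.
by apply: generated_mem; exists (a * c), s, b; split; rewrite ?mulrA.
Qed.

Lemma OS_ideal_mulr (a x : ext (lattW N)) : x \in OS_ideal -> x * a \in OS_ideal.
Proof.
move=> /gensubP Ix; apply/gensubP; move: x Ix.
apply: generated_min => [|x1 x2 H1 H2|x1 H1|_ [c [s [b [us ds ->]]]]].
- by rewrite mul0r; apply: generated0.
- by rewrite mulrDl; apply: generated_add.
- by rewrite mulNr; apply: generated_opp.
by apply: generated_mem; exists c, s, (b * a); split; rewrite ?mulrA.
Qed.

Definition OS_ideal0 : {pred extW0 N} := fun x => val x \in OS_ideal.

Lemma OS_ideal0_zmod : zmod_closed OS_ideal0.
Proof.
split; first by rewrite unfold_in raddf0 rpred0.
by move=> x y Ix Iy; rewrite unfold_in raddfB rpredB.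
Qed.
HB.instance Definition _ :=
  GRing.isZmodClosed.Build (extW0 N) OS_ideal0 OS_ideal0_zmod.

Lemma OS_ideal0_mull (a x : extW0 N) : x \in OS_ideal0 -> a * x \in OS_ideal0.
Proof. by move=> Ix; rewrite unfold_in rmorphM; apply: OS_ideal_mull. Qed.
Lemma OS_ideal0_mulr (a x : extW0 N) : x \in OS_ideal0 -> x * a \in OS_ideal0.
Proof. by move=> Ix; rewrite unfold_in rmorphM; apply: OS_ideal_mulr. Qed.
HB.instance Definition _ := isTwoSidedIdeal.Build (extW0 N) OS_ideal0
  OS_ideal0_mull OS_ideal0_mulr.

Definition OS0 : pzRingType := ring_quot OS_ideal0.

Definition OS0_class (x : extW0 N) : OS0 := rq_class x.

Definition OS0_deg (k : nat) (x : OS0) : Prop :=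
  exists2 y : extW0 N, homogeneous k (val y) & x = OS0_class y.
End OrlikSolomon.

Section BergmanFan.
Context (R : realType) {N : nat} (M : matroid 'I_N.+1).

(* V_0 (x) R, in the coordinates of V_0 *)
Definition V0real : Type := 'rV[R]_(dim (lattV0 N)).
HB.instance Definition _ := Vector.copy V0real 'rV[R]_(dim (lattV0 N)).

Definition realify (v : lattV0 N) : V0real := map_mx intr (v2r v).

Definition vecJ (J : {set 'I_N.+1}) : lattV0 N := classV0 (\sum_(i in J) vecE i).

Definition conic_hull (s : seq V0real) (x : V0real) : Prop :=
  exists2 a : 'I_(size s) -> R,
    forall i, 0 <= a i & x = \sum_(i < size s) a i *: s`_i.

Definition linear_span (A : V0real -> Prop) (x : V0real) : Prop :=
  exists (s : seq V0real) (a : 'I_(size s) -> R),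
    (forall y, y \in s -> A y) /\ x = \sum_(i < size s) a i *: s`_i.

Definition bergman_fan (sigma : V0real -> Prop) : Prop :=
  exists2 Js, flag M Js & sigma = conic_hull [seq realify (vecJ J) | J <- Js].

Definition cone_lattice (sigma : V0real -> Prop) (v : lattV0 N) : Prop :=
  linear_span sigma (realify v).

Definition in_tropF (k : nat) : {pred ext (lattV0 N)} :=
  gensub (fun x => exists2 sigma, bergman_fan sigma &
    exists vs : k.-tuple (lattV0 N),
      (forall i, cone_lattice sigma (tnth vs i)) /\ x = wedge vs).
HB.instance Definition _ k := GRing.ZmodClosed.on (in_tropF k).

Definition tropF (k : nat) : Type := {x : ext (lattV0 N) | x \in in_tropF k}.
HB.instance Definition _ k := SubChoice.on (tropF k).
HB.instance Definition _ k := [SubChoice_isSubZmodule of tropF k by <:].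

(* The product of all the groups F^k; as F_k = 0 for k > N it is their direct
   sum, with homogeneous components [trop_deg]. *)
Definition trop_coh : Type := forall k : nat, {additive tropF k -> int}.

Definition trop_add (alpha beta : trop_coh) : trop_coh :=
  fun k => alpha k \+ beta k.

Definition trop_deg (k : nat) (alpha : trop_coh) : Prop :=
  forall j, j != k -> forall x, alpha j x = 0.

Section Restriction.
Variable om : ext (dualV0 N).

Definition restrict_form k (x : tropF k) : int := pairing om (val x).

Lemma restrict_form_zmod_morphism k : zmod_morphism (@restrict_form k).
Proof. by move=> x y; rewrite /restrict_form raddfB pairingBr. Qed.
HB.instance Definition _ k := GRing.isZmodMorphism.Build (tropF k) int
  (@restrict_form k) (@restrict_form_zmod_morphism k).

Definition trop_restrict : trop_coh := @restrict_form.
End Restriction.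

Definition trop_one : trop_coh := trop_restrict 1.

(* The product induced by the wedge product of forms: choose forms restricting
   to the given classes (0 by default, if there are none), and restrict their
   wedge product.  The result does not depend on the choice, because the forms
   with zero restriction are an ideal. *)
Definition trop_lift (alpha : trop_coh) : ext (dualV0 N) :=
  classical_sets.xget 0 (fun om => trop_restrict om = alpha).

Definition trop_mul (alpha beta : trop_coh) : trop_coh :=
  trop_restrict (trop_lift alpha * trop_lift beta).
End BergmanFan.

(* Main.v *)
From HB Require Import structures.
Require Import Defs.
From mathcomp Require Import all_boot all_order perm all_algebra.
From mathcomp Require Import boolp reals.
From mathcomp Require classical_sets.
From mathcomp Require Import zify.

Set Implicit Arguments.
Unset Strict Implicit.
Unset Printing Implicit Defensive.

Import Order.TTheory GRing.Theory Num.Theory.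
Import VectorInternalTheory.

Local Open Scope ring_scope.

(** The identification of W_0 with the dual of V_0 extends to a surjective algebra
    morphism [ext_proj] from the exterior algebra of W onto that of the dual, which
    is bijective on the exterior algebra of W_0.  Composed with the restriction of
    forms, it gives the isomorphism once two things are known: the forms of W_0 that
    restrict to zero are exactly those of the Orlik-Solomon ideal, and every
    homomorphism from F_k to Z is the restriction of a form.

    The ideal restricts to zero ([OS_ideal_vanish]).  The boundary of F_I, with
    c in I, is up to sign the product of the f_t - f_c, t in I, t <> c.  Let I be
    dependent, and fix a flag of flats.  If every two elements of I were separated by
    a flat of the flag, then each element would lie outside a flat containing the
    preceding ones, and I would be independent ([flag_separated_indep]).  So two
    elements p, q of I belong to the same flats of the flag, f_p and f_q agree on the
    cone, and the determinant that evaluates the product has a zero row or two equal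
    rows ([boundary_vanish]).

    The converse and the surjectivity come from bases.  Let S be a set without broken
    circuits that does not contain 0; then each i in S is the least element of the
    closure J_i of the elements of S from i on ([upper_flat_min]), and the J_i form a
    flag of proper flats.  Let x_S be the product of the vectors e_(J_i), an element
    of F_k with k = |S|, and let Y_T be the product of the f_t - f_0, t in T.  The
    value of Y_T on x_S is the determinant of the incidence matrix of the elements of
    T and the flats J_i.  It is 1 for S = T ([nbc_pairing_diag]), and it can only be
    nonzero if the sum of the elements of T exceeds that of S or T = S
    ([nbc_triangular]): the matrix of all these values is unitriangular over Z.
    On the other hand, the Y_T without broken circuits span the exterior algebra of
    W_0 modulo the ideal ([extW0_spanned]), because the boundary of a dependent set
    lets one trade an element for a smaller one.

    Triangularity then does the rest.  If a combination of the Y_T and of an element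
    of the ideal restricts to zero, then its coefficients vanish, so it lies in the
    ideal ([trop_restrict_inj]).  An element of F_k can be corrected by a combination
    of the x_S so that all Y_T, hence all forms, vanish on it; the pairing being
    nondegenerate, the x_S generate F_k ([tropF_nbc_expansion]).  And a combination of
    the Y_T with prescribed values on the x_S exists ([trop_restrict_nbc]). *)

(** * Alternating multilinear functions of lists of vectors *)

Lemma repeated_entry (T : eqType) (s : seq T) :
  ~~ uniq s -> exists i r, perm_eq s (i :: i :: r).
Proof.
elim: s => //= i s IH; rewrite negb_and negbK; case: (boolP (i \in s)) => [si _|_ /= /IH].
  by exists i, (rem i s); rewrite perm_cons perm_to_rem.
case=> j [r sr]; exists j, (i :: r); rewrite -(perm_cons i) in sr.
by apply: (perm_trans sr); rewrite (perm_catCA [:: i] [:: j; j] r).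
Qed.

Section Alternating.
Context {R : comNzRingType} {V : vectType R}.
Implicit Types (p q us vs : seq V) (v w : V).

Definition multilinear (M : lmodType R) (Phi : seq V -> M) : Prop :=
  forall p q a v w,
    Phi (p ++ (a *: v + w) :: q) = a *: Phi (p ++ v :: q) + Phi (p ++ w :: q).

Definition alternating (M : lmodType R) (Phi : seq V -> M) : Prop :=
  forall p q v, Phi (p ++ v :: v :: q) = 0.

Definition basis_vec (i : 'I_(dim V)) : V := r2v (delta_mx 0 i).

Lemma basis_expansion v : v = \sum_i v2r v 0 i *: basis_vec i.
Proof.
apply: (can_inj v2rK); rewrite linear_sum; apply/rowP => j.
rewrite summxE (bigD1 j) //= big1 => [|i /negPf ne];
  rewrite linearZ /= r2vK !mxE /= ?eqxx ?mulr1 ?addr0 //.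
by rewrite eq_sym ne mulr0.
Qed.

Lemma basis_seqE S : basis_seq S = map basis_vec (enum S) :> seq V.
Proof. by []. Qed.

Section Uniqueness.
Variables (M : lmodType R) (Phi : seq V -> M).
Hypothesis linPhi : multilinear Phi.
Hypothesis altPhi : alternating Phi.

Lemma multilinear0 p q : Phi (p ++ 0 :: q) = 0.
Proof.
have := linPhi p q (-1) 0 0; rewrite scaler0 add0r scaleN1r => ->.
by rewrite addNr.
Qed.

Lemma multilinear_sum p q (I : finType) (a : I -> R) (f : I -> V) :
  Phi (p ++ (\sum_i a i *: f i) :: q) = \sum_i a i *: Phi (p ++ f i :: q).
Proof.
elim/big_rec2: _ => [|i v w _ <-]; first exact: multilinear0.
by rewrite linPhi.
Qed.

Lemma alternating_swap p q v w : Phi (p ++ v :: w :: q) = - Phi (p ++ w :: v :: q).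
Proof.
have addv u u' s s' : Phi (s ++ (u + u') :: s') = Phi (s ++ u :: s') + Phi (s ++ u' :: s').
  by have := linPhi s s' 1 u u'; rewrite !scale1r.
have := altPhi p q (v + w).
rewrite addv -[p ++ v :: (v + w) :: q](cat_rcons v p) -[p ++ w :: (v + w) :: q](cat_rcons w p).
rewrite !addv !cat_rcons !altPhi add0r addr0 => /eqP.
by rewrite addr_eq0 => /eqP.
Qed.

Lemma alternating_perm us vs :
  perm_eq us vs -> Phi vs = Phi us \/ Phi vs = - Phi us.
Proof.
pose pm (x : M) := x = Phi us \/ x = - Phi us.
have pmN x : pm x -> pm (- x) by case=> ->; rewrite ?opprK; [right | left].
have shift p v s q : pm (Phi (p ++ v :: s ++ q)) -> pm (Phi (p ++ s ++ v :: q)).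
  elim: s p => [|w s IH] p //= /pmN; rewrite alternating_swap opprK.
  by rewrite -!(cat_rcons w p) => /IH.
have rot s1 s2 s3 : pm (Phi (s1 ++ s2 ++ s3)) -> pm (Phi (s2 ++ s1 ++ s3)).
  elim/last_ind: s1 s3 => [|s1 v IH] s3; first by rewrite !cat0s.
  by rewrite !cat_rcons => /(shift s1) /IH.
by move=> /(@catCA_perm_ind _ (fun s => pm (Phi s)) rot) H; apply: H; left.
Qed.

Lemma alternating_perm0 us vs : perm_eq us vs -> Phi us = 0 -> Phi vs = 0.
Proof. by move=> /alternating_perm [] -> ->; rewrite ?oppr0. Qed.

Lemma alternating_not_uniq us : ~~ uniq us -> Phi us = 0.
Proof.
move=> /repeated_entry[v [vs]]; rewrite perm_sym => /alternating_perm0; apply.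
exact: (altPhi [::]).
Qed.

(** Expanding each entry in the basis leaves lists of basis vectors; such a list
    is, up to order, an increasing one, or it repeats an entry. *)
Lemma alternating_eq0 : (forall S, Phi (basis_seq S) = 0) -> forall vs, Phi vs = 0.
Proof.
move=> Phi0 vs.
suff H us (s : seq 'I_(dim V)) : Phi (map basis_vec s ++ us) = 0 by apply: (H vs [::]).
elim: us s => [|v us IH] s; last first.
  rewrite (basis_expansion v) multilinear_sum big1 // => i _.
  by rewrite -[_ ++ _ :: _]cat_rcons -map_rcons IH scaler0.
rewrite cats0; case: (boolP (uniq s)) => [us|nus]; last first.
  apply: alternating_not_uniq; apply: contra nus; exact: map_uniq.
have sE : perm_eq (basis_seq [set i in s] : seq V) (map basis_vec s).
  rewrite basis_seqE; apply: perm_map; apply: uniq_perm => //; first exact: enum_uniq.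
  by move=> i; rewrite mem_enum inE.
exact: alternating_perm0 sE (Phi0 _).
Qed.
End Uniqueness.

Lemma wedge_cat us vs : wedge (us ++ vs) = wedge us * wedge vs :> ext V.
Proof. by rewrite /wedge big_cat. Qed.

Lemma wedge_cons v vs : wedge (v :: vs) = ext_vec v * wedge vs :> ext V.
Proof. by rewrite /wedge big_cons. Qed.

Lemma ext_vec_linear : linear (ext_vec : V -> ext V).
Proof.
move=> a v w; rewrite /ext_vec scaler_sumr -big_split; apply: eq_bigr => i _.
by rewrite linearP !mxE scalerDl scalerA.
Qed.

HB.instance Definition _ :=
  GRing.isLinear.Build R V (ext V) _ (ext_vec : V -> ext V) ext_vec_linear.

Lemma wedge_multilinear : multilinear (wedge : seq V -> ext V).
Proof.
move=> p q a v w; rewrite !wedge_cat !wedge_cons linearP mulrDl mulrDr.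
by rewrite -scalerAl -scalerAr.
Qed.

Lemma wedge_alternating : alternating (wedge : seq V -> ext V).
Proof.
move=> p q v.
by rewrite wedge_cat !wedge_cons [ext_vec v * (_ * _)]mulrA ext_vec_sq mul0r mulr0.
Qed.

Lemma ext_expansion (x : ext V) : x = \sum_S x S *: wedge (basis_seq S).
Proof.
apply/ffunP => T; rewrite sum_ffunE (bigD1 T) //= big1 => [|S /negPf ne].
  by rewrite addr0 -ext_monomialE !ffunE eqxx /GRing.scale /= mulr1.
by rewrite -ext_monomialE !ffunE eq_sym ne scaler0.
Qed.

(** The universal property of the exterior powers, all degrees at once: the
    difference of the two sides is alternating and vanishes on increasing lists
    of basis vectors. *)
Lemma alternating_expand (M : lmodType R) (Phi : seq V -> M) :
  multilinear Phi -> alternating Phi ->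
  forall vs, Phi vs = \sum_S (wedge vs : ext V) S *: Phi (basis_seq S).
Proof.
move=> linPhi altPhi vs; apply/eqP; rewrite -subr_eq0; apply/eqP; move: vs.
apply: alternating_eq0 => [p q a v w|p q v|S].
- rewrite linPhi scalerBr scaler_sumr addrACA -opprD -big_split /=.
  congr (_ - _); apply: eq_bigr => S _.
  by rewrite wedge_multilinear !ffunE scalerDl scalerA.
- rewrite altPhi sub0r big1 ?oppr0 // => S _.
  by rewrite wedge_alternating ffunE scale0r.
rewrite -ext_monomialE (bigD1 S) //= big1 => [|T /negPf ne].
  by rewrite ffunE eqxx scale1r addr0 subrr.
by rewrite ffunE ne scale0r.
Qed.
End Alternating.

(** * Algebra morphisms out of an exterior algebra *)

Section Lift.
Context {R : comNzRingType} {V : vectType R} {A : algType R}.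
Variable g : {linear V -> A}.
Hypothesis g_sq : forall v, g v * g v = 0.

Definition ext_lift (x : ext V) : A := \sum_S x S *: \prod_(v <- basis_seq S) g v.

Lemma ext_lift_wedge vs : ext_lift (wedge vs) = \prod_(v <- vs) g v.
Proof.
rewrite /ext_lift; symmetry; apply: (@alternating_expand _ _ A (fun vs => \prod_(v <- vs) g v)).
- move=> p q a v w; rewrite !big_cat !big_cons /= linearP mulrDl mulrDr.
  by rewrite -scalerAl -scalerAr.
- by move=> p q v; rewrite big_cat !big_cons /= [g v * (_ * _)]mulrA g_sq mul0r mulr0.
Qed.

Lemma ext_lift_linear : linear ext_lift.
Proof.
move=> a x y; rewrite /ext_lift scaler_sumr -big_split; apply: eq_bigr => S _.
by rewrite !ffunE scalerDl scalerA.
Qed.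

HB.instance Definition _ := GRing.isLinear.Build R (ext V) A _ ext_lift ext_lift_linear.

Lemma ext_lift1 : ext_lift 1 = 1.
Proof. by have := ext_lift_wedge [::]; rewrite /wedge !big_nil. Qed.

Lemma ext_liftM x y : ext_lift (x * y) = ext_lift x * ext_lift y.
Proof.
rewrite (ext_expansion x) (ext_expansion y) mulr_suml !linear_sum mulr_suml.
apply: eq_bigr => S _; rewrite !mulr_sumr linear_sum; apply: eq_bigr => T _.
rewrite -scalerAl -scalerAr -wedge_cat !linearZ /= !ext_lift_wedge big_cat.
by rewrite -scalerAl -scalerAr.
Qed.
End Lift.

(** * The determinantal pairing *)

Section Homogeneous.
Context {R : comNzRingType} {V : vectType R}.

Lemma wedge_homogeneous (vs : seq V) : homogeneous (size vs) (wedge vs : ext V).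
Proof.
move=> S; apply: contra_neq_eq => neS.
(* the coefficient at [S], except in the degree where it may be nonzero *)
pose Phi (us : seq V) : R^o := if #|S| == size us then 0 else (wedge us : ext V) S.
suff : Phi vs = 0 by rewrite /Phi (negPf neS).
apply: alternating_eq0 => [p q a v w|p q v|T]; rewrite /Phi.
- rewrite !size_cat /=; case: ifP => _; first by rewrite scaler0 addr0.
  by rewrite wedge_multilinear !ffunE.
- case: ifP => _ //.
  by rewrite wedge_alternating ffunE.
rewrite size_map -cardE -ext_monomialE ffunE; case: eqP => // neST.
by case: eqP => // ST; rewrite ST in neST.
Qed.
End Homogeneous.

Section Pairing.
Context {R : comNzRingType} {V : vectType R}.
Notation dual := 'Hom(V, R^o).
Implicit Types (us : seq dual) (vs : seq V) (om : ext dual) (x : ext V).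

Lemma det_pairing_neq us vs : size us != size vs -> det_pairing us vs = 0.
Proof. by rewrite /det_pairing => /negPf ->. Qed.

Lemma det_pairing_sized k us vs : size us = k -> size vs = k ->
  det_pairing us vs = \det (\matrix_(a < k, b < k) (us`_a vs`_b : R)).
Proof. by move=> su sv; rewrite /det_pairing su sv eqxx. Qed.

Lemma nth_cat_mid (T : Type) (x0 : T) p q y : nth x0 (p ++ y :: q) (size p) = y.
Proof. by rewrite nth_cat ltnn subnn. Qed.

Lemma nth_cat_other (T : Type) (x0 : T) p q y y' (i : nat) :
  size p != i -> nth x0 (p ++ y :: q) i = nth x0 (p ++ y' :: q) i.
Proof. by rewrite !nth_cat; case: ltngtP => // /subnSK <-. Qed.

Lemma det_pairing_multilinear_l vs : multilinear (fun us => det_pairing us vs : R^o).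
Proof.
move=> p q a v w; have sz (y : dual) : size (p ++ y :: q) = (size p + (size q).+1)%N.
  by rewrite size_cat.
case: (eqVneq (size vs) (size p + (size q).+1)%N) => [sv|ne]; last first.
  by rewrite !det_pairing_neq ?sz 1?eq_sym // scaler0 addr0.
rewrite !(det_pairing_sized (sz _) sv).
have lt_p : (size p < size p + (size q).+1)%N by lia.
rewrite [X in _ = X + _]/(_ * _) -[X in _ = _ + X]mul1r.
apply: (determinant_multilinear (i0 := Ordinal lt_p)).
- apply/rowP => b; rewrite !mxE /= !nth_cat_mid mul1r.
  by rewrite lfunE /= lfunE.
- apply/matrixP => i j; rewrite !mxE; congr ((_ : dual) _).
  by apply: nth_cat_other; rewrite -[size p]/(val (Ordinal lt_p)) (inj_eq val_inj) neq_lift.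
- apply/matrixP => i j; rewrite !mxE; congr ((_ : dual) _).
  by apply: nth_cat_other; rewrite -[size p]/(val (Ordinal lt_p)) (inj_eq val_inj) neq_lift.
Qed.

Lemma det_pairing_multilinear_r us : multilinear (fun vs => det_pairing us vs : R^o).
Proof.
move=> p q a v w; have sz (y : V) : size (p ++ y :: q) = (size p + (size q).+1)%N.
  by rewrite size_cat.
case: (eqVneq (size us) (size p + (size q).+1)%N) => [su|ne]; last first.
  by rewrite !det_pairing_neq ?sz // scaler0 addr0.
rewrite !(det_pairing_sized su (sz _)) -!(det_tr (\matrix_(_, _) _)).
have lt_p : (size p < size p + (size q).+1)%N by lia.
rewrite [X in _ = X + _]/(_ * _) -[X in _ = _ + X]mul1r.
apply: (determinant_multilinear (i0 := Ordinal lt_p)).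
- by apply/rowP => b; rewrite !mxE /= !nth_cat_mid mul1r linearP.
- apply/matrixP => i j; rewrite !mxE; congr ((_ : dual) _).
  by apply: nth_cat_other; rewrite -[size p]/(val (Ordinal lt_p)) (inj_eq val_inj) neq_lift.
- apply/matrixP => i j; rewrite !mxE; congr ((_ : dual) _).
  by apply: nth_cat_other; rewrite -[size p]/(val (Ordinal lt_p)) (inj_eq val_inj) neq_lift.
Qed.

Lemma det_pairing_zero_row us vs u :
  u \in us -> (forall v, v \in vs -> u v = 0) -> det_pairing us vs = 0.
Proof.
move=> uus u0; case: (eqVneq (size us) (size vs)) => [sz|/det_pairing_neq //].
rewrite (det_pairing_sized (erefl _) (esym sz)).
have lt_i : (index u us < size us)%N by rewrite index_mem.
rewrite (expand_det_row _ (Ordinal lt_i)) big1 // => b _.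
by rewrite mxE nth_index // u0 ?mul0r // mem_nth // -sz.
Qed.

Lemma det_pairing_equal_rows us vs i j :
  i != j -> (i < size us)%N -> (j < size us)%N ->
  (forall v, v \in vs -> us`_i v = us`_j v) -> det_pairing us vs = 0.
Proof.
move=> ij ius jus eqij; case: (eqVneq (size us) (size vs)) => [sz|/det_pairing_neq //].
rewrite (det_pairing_sized (erefl _) (esym sz)).
apply: (@determinant_alternate _ _ _ (Ordinal ius) (Ordinal jus)) => // b.
by rewrite !mxE /= eqij // mem_nth // -sz.
Qed.

Lemma det_pairing_alternating_l vs : alternating (fun us => det_pairing us vs : R^o).
Proof.
move=> p q v; apply: (@det_pairing_equal_rows _ _ (size p) (size p).+1).
- by rewrite neq_ltn ltnSn.
- by rewrite size_cat /= !addnS !ltnS leqW // leq_addr.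
- by rewrite size_cat /= !addnS !ltnS leq_addr.
by move=> w _; rewrite !nth_cat ltnn ltnNge leqnSn subnn subSnn.
Qed.

Lemma det_pairing_alternating_r us : alternating (fun vs => det_pairing us vs : R^o).
Proof.
move=> p q v; case: (eqVneq (size us) (size (p ++ v :: v :: q))) => [sz|/det_pairing_neq //].
rewrite (det_pairing_sized sz (erefl _)) -det_tr.
have lt1 : ((size p).+1 < size (p ++ [:: v, v & q]))%N by rewrite size_cat /=; lia.
apply: (@determinant_alternate _ _ _ (Ordinal (ltnW lt1)) (Ordinal lt1)).
  by rewrite -val_eqE /= neq_ltn ltnSn.
by move=> b; rewrite !mxE /= !nth_cat ltnn ltnNge leqnSn subnn subSnn.
Qed.

(** The double sum defining the pairing is the expansion of [det_pairing] in each of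
    its two arguments. *)
Lemma pairing_wedge us vs : pairing (wedge us) (wedge vs) = det_pairing us vs.
Proof.
have /(_ us) -> := alternating_expand (det_pairing_multilinear_l vs) (det_pairing_alternating_l vs).
apply: eq_bigr => S _.
have /(_ vs) -> := alternating_expand (det_pairing_multilinear_r (basis_seq S))
  (det_pairing_alternating_r _).
rewrite scaler_sumr; apply: eq_bigr => T _; by rewrite /GRing.scale /= mulrA.
Qed.

Lemma pairing_linear_l x : linear (fun om => pairing om x : R^o).
Proof.
move=> a om om'; rewrite /pairing scaler_sumr -big_split; apply: eq_bigr => S _ /=.
rewrite scaler_sumr -big_split; apply: eq_bigr => T _ /=.
by rewrite !ffunE /GRing.scale /= !mulrDl !mulrA.
Qed.

Lemma pairing_linear_r om : linear (fun x => pairing om x : R^o).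
Proof.
move=> a x x'; rewrite /pairing scaler_sumr -big_split; apply: eq_bigr => S _ /=.
rewrite scaler_sumr -big_split; apply: eq_bigr => T _ /=.
by rewrite !ffunE /GRing.scale /= mulrDr !mulrDl !mulrA [om S * a]mulrC.
Qed.

Lemma pairing0l x : pairing 0 x = 0.
Proof. by rewrite /pairing big1 // => S _; rewrite big1 // => T _; rewrite ffunE !mul0r. Qed.

Lemma pairing0r om : pairing om 0 = 0.
Proof. by rewrite -(subrr 0) pairingBr subrr. Qed.

Lemma pairingDl om om' x : pairing (om + om') x = pairing om x + pairing om' x.
Proof. by have := pairing_linear_l x 1 om om'; rewrite !scale1r. Qed.

Lemma pairingNl om x : pairing (- om) x = - pairing om x.
Proof. by apply/eqP; rewrite -addr_eq0 -pairingDl addNr pairing0l. Qed.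

Lemma pairingZl a om x : pairing (a *: om) x = a * pairing om x.
Proof. by have := pairing_linear_l x a om 0; rewrite pairing0l !addr0. Qed.

Lemma pairingZr a om x : pairing om (a *: x) = a * pairing om x.
Proof. by have := pairing_linear_r om a x 0; rewrite pairing0r !addr0. Qed.

Lemma pairingDr om x x' : pairing om (x + x') = pairing om x + pairing om x'.
Proof. by have := pairing_linear_r om 1 x x'; rewrite !scale1r. Qed.

Lemma pairing_suml (I : Type) (r : seq I) (P : pred I) (F : I -> ext dual) x :
  pairing (\sum_(i <- r | P i) F i) x = \sum_(i <- r | P i) pairing (F i) x.
Proof. by apply: (big_morph (fun om => pairing om x)) => [? ?|]; rewrite ?pairingDl ?pairing0l. Qed.

Lemma pairing_sumr (I : Type) (r : seq I) (P : pred I) om (F : I -> ext V) :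
  pairing om (\sum_(i <- r | P i) F i) = \sum_(i <- r | P i) pairing om (F i).
Proof. by apply: (big_morph (pairing om)) => [? ?|]; rewrite ?pairingDr ?pairing0r. Qed.

Lemma pairing_homogeneous j k om x :
  homogeneous j om -> homogeneous k x -> j != k -> pairing om x = 0.
Proof.
move=> hom hx jk; rewrite /pairing big1 // => S _; rewrite big1 // => T _.
case: (eqVneq (om S) 0) => [->|/hom sS]; first by rewrite !mul0r.
case: (eqVneq (x T) 0) => [->|/hx sT]; first by rewrite mulr0 mul0r.
by rewrite det_pairing_neq ?mulr0 // !size_map -!cardE sS sT.
Qed.

Lemma pairing_mul_wedge om us om' vs :
  (forall p q, det_pairing (p ++ us ++ q) vs = 0) ->
  pairing (om * wedge us * om') (wedge vs) = 0.
Proof.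
move=> det0; rewrite (ext_expansion om) (ext_expansion om') mulr_suml mulr_suml.
rewrite pairing_suml big1 // => S _; rewrite mulr_sumr pairing_suml big1 // => T _.
by rewrite -!scalerAl -scalerAr !pairingZl -!wedge_cat -catA pairing_wedge det0 !mulr0.
Qed.

Definition coord_form (i : 'I_(dim V)) : dual := linfun (fun v => v2r v 0 i : R^o).

Lemma coord_formE i v : coord_form i v = v2r v 0 i.
Proof.
have lin : linear (fun v : V => v2r v 0 i : R^o) by move=> a u w; rewrite linearP !mxE.
pose f : {linear V -> R^o} := HB.pack (fun v : V => v2r v 0 i : R^o)
  (GRing.isLinear.Build _ _ _ _ _ lin).
by rewrite /coord_form (lfunE f).
Qed.

(** The products of coordinate forms are dual to the monomials: their determinants
    are those of the identity or have a zero row. *)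
Lemma pairing_coord_form (S : {set 'I_(dim V)}) x :
  pairing (wedge (map coord_form (enum S))) x = x S.
Proof.
rewrite {1}(ext_expansion x) pairing_sumr (bigD1 S) //= big1 => [|T neT].
  rewrite addr0 pairingZr pairing_wedge basis_seqE.
  rewrite (@det_pairing_sized #|S|) ?size_map -?cardE //.
  set A := \matrix_(a, b) _; suff -> : A = 1%:M by rewrite det1 mulr1.
  apply/matrixP => a b; have i0 : 'I_(dim V) by have := enum_val a.
  rewrite !mxE !(nth_map i0) -?cardE // coord_formE /basis_vec r2vK mxE eqxx /=.
  by rewrite nth_uniq ?enum_uniq -?cardE.
rewrite pairingZr pairing_wedge basis_seqE.
case: (eqVneq #|S| #|T|) => [ST|neST]; last first.
  by rewrite det_pairing_neq ?mulr0 // !size_map -!cardE.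
have /subsetPn[i iS iT] : ~~ (S \subset T).
  by apply: contra neT => sST; rewrite eq_sym eqEcard sST ST leqnn.
rewrite (@det_pairing_zero_row _ _ (coord_form i)) ?mulr0 //.
  by rewrite map_f // mem_enum.
move=> v /mapP[j]; rewrite mem_enum => jT ->.
rewrite coord_formE /basis_vec r2vK mxE eqxx /=.
by case: eqP => // ij; rewrite ij jT in iT.
Qed.

Lemma pairing_nondegenerate x : (forall om, pairing om x = 0) -> x = 0.
Proof. by move=> x0; apply/ffunP => S; rewrite -pairing_coord_form x0 ffunE. Qed.
End Pairing.

(** * Flats and closures of a matroid *)

Section Matroid.
Context {T : finType} (M : matroid T).
Implicit Types (A B C F : {set T}) (x : T).

Lemma indep_leq_rank A B : indep M A -> A \subset B -> (#|A| <= mrank M B)%N.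
Proof.
by move=> iA sAB; apply: (leq_bigmax_cond (F := fun A : {set T} => #|A|)); rewrite iA.
Qed.

Lemma rank_witness B : exists2 A, indep M A & (A \subset B) && (#|A| == mrank M B).
Proof.
have [|A] := @eq_bigmax_cond _ [pred A | indep M A && (A \subset B)] (fun A : {set T} => #|A|).
  by apply/card_gt0P; exists set0; rewrite inE indep_set0 sub0set.
by rewrite inE => /andP[iA sA] EA; exists A; rewrite // sA /mrank EA eqxx.
Qed.

Lemma indep_extend A B : indep M A -> A \subset B ->
  exists2 C, indep M C & [&& A \subset C, C \subset B & #|C| == mrank M B].
Proof.
have [D iD /andP[sD /eqP rD]] := rank_witness B.
have [m] := ubnP (mrank M B - #|A|); elim: m A => // m IH A ltm iA sA.
have [ge|lt] := leqP #|D| #|A|.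
  by exists A => //; rewrite subxx sA eqn_leq indep_leq_rank //= -rD.
have [x /setDP[xD xA] ixA] := indep_exchange iA iD lt.
have sxA : x |: A \subset B by rewrite subUset sub1set (subsetP sD).
have [|C iC /and3P[sC sCB rC]] := IH _ _ ixA sxA.
  by rewrite cardsU1 xA; lia.
by exists C; rewrite // sCB rC (subset_trans _ sC) ?subsetU1.
Qed.

(** Otherwise [A] would extend to an independent set of the rank of [x |: F] that
    avoids [x], so [x] would not raise the rank of [F]. *)
Lemma flat_extend F A x : flat M F -> indep M A -> A \subset F -> x \notin F ->
  indep M (x |: A).
Proof.
move=> /forallP /(_ x) /implyP fF iA sA xF; have {}fF := fF xF.
have [C iC /and3P[sAC sCF /eqP rC]] := indep_extend iA (subset_trans sA (subsetU1 x F)).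
apply: (indep_sub _ iC); rewrite subUset sub1set sAC andbT.
apply: contraLR fF => xC; rewrite -leqNgt -rC indep_leq_rank //.
by apply/subsetP => y yC; have /setU1P[yx|//] := subsetP sCF y yC; rewrite -yx yC in xC.
Qed.

(** Ordering the elements of [C] along the flag, each one lies outside a flat that
    contains the preceding ones. *)
Lemma flag_separated_indep Js C : loopless M -> flag M Js ->
  {in C &, forall p q, (forall J, J \in Js -> (p \in J) = (q \in J)) -> p = q} ->
  indep M C.
Proof.
move=> loopM /andP[/allP flatJs]; rewrite sorted_pairwise; last first.
  by move=> ? ? ?; apply: proper_trans.
elim/last_ind: Js C flatJs => [|Js J IH] C flatJs sJs sepC.
  have [->|[x xC]] := set_0Vmem C; first exact: indep_set0.
  suff -> : C = [set x] by apply: loopM.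
  by apply/setP => y; rewrite inE; apply/idP/eqP => [yC|->//]; apply: sepC.
move: sJs; rewrite pairwise_rcons => /andP[/allP ltJ sJs].
have /and3P[flatJ _ _] : proper_flat M J by apply: flatJs; rewrite mem_rcons inE eqxx.
have iCJ : indep M (C :&: J).
  apply: IH => // [K KJs|p q /setIP[pC pJ] /setIP[qC qJ] eqpq].
    by apply: flatJs; rewrite mem_rcons inE KJs orbT.
  apply: sepC => // K; rewrite mem_rcons inE => /predU1P[->|/eqpq //].
  by rewrite pJ qJ.
have [CJ|[x xCJ]] := set_0Vmem (C :\: J).
  by rewrite -(setID C J) CJ setU0.
have /setDP[xC xJ] := xCJ.
suff -> : C = x |: (C :&: J) by apply: flat_extend flatJ iCJ (subsetIr _ _) xJ.
apply/setP => y; rewrite !inE; case: (boolP (y \in J)) => yJ.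
  by rewrite andbT; case: eqP => // ->.
rewrite andbF orbF; apply/idP/eqP => [yC|->//]; apply: sepC => // K.
have out z : z \notin J -> K \in Js -> z \notin K.
  by move=> zJ /ltJ /proper_sub sKJ; apply: contra zJ; apply: (subsetP sKJ).
rewrite mem_rcons inE => /predU1P[->|KJs]; first by rewrite (negPf yJ) (negPf xJ).
by rewrite (negPf (out _ yJ KJs)) (negPf (out _ xJ KJs)).
Qed.

Definition mclosure A : {set T} := [set x | mrank M (x |: A) == mrank M A].

Lemma rank_mono A B : A \subset B -> (mrank M A <= mrank M B)%N.
Proof.
move=> sAB; have [C iC /andP[sC /eqP <-]] := rank_witness A.
by apply: indep_leq_rank => //; apply: subset_trans sAB.
Qed.

Lemma sub_mclosure A : A \subset mclosure A.
Proof. by apply/subsetP => x xA; rewrite inE (setUidPr _) ?sub1set. Qed.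

Lemma notin_mclosure A x : x \notin mclosure A -> (mrank M A < mrank M (x |: A))%N.
Proof. by rewrite inE => ne; rewrite ltn_neqAle eq_sym ne rank_mono ?subsetU1. Qed.

Lemma mclosure_dep A x : x \in mclosure A -> x \notin A -> ~~ indep M (x |: A).
Proof.
rewrite inE => /eqP rA xA; apply/negP => ixA.
have := indep_leq_rank ixA (subxx _); rewrite rA cardsU1 xA.
have [C iC /andP[sC /eqP <-]] := rank_witness A.
by have := subset_leq_card sC; lia.
Qed.

Lemma rank_mclosure A : mrank M (mclosure A) = mrank M A.
Proof.
apply/eqP; rewrite eqn_leq (rank_mono (sub_mclosure A)) andbT leqNgt; apply/negP.
have [B iB /andP[sB /eqP rB]] := rank_witness A.
have [D iD /andP[sD /eqP <-]] := rank_witness (mclosure A).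
rewrite -rB => /(indep_exchange iB iD)[x /setDP[xD xB] ixB].
have := subsetP sD x xD; rewrite inE => /eqP rxA.
have := indep_leq_rank ixB (setUS [set x] sB); rewrite rxA cardsU1 xB rB; lia.
Qed.

Lemma mclosure_flat A : flat M (mclosure A).
Proof.
apply/forallP => x; apply/implyP => /notin_mclosure lt.
by rewrite rank_mclosure (leq_trans lt) // rank_mono // setUS // sub_mclosure.
Qed.

Lemma mclosureS A B : A \subset B -> mclosure A \subset mclosure B.
Proof.
move=> sAB; apply/subsetP => x; apply: contraLR => xB.
have [C iC /andP[sC /eqP rC]] := rank_witness A.
have xA : x \notin A by apply: contra xB => /(subsetP sAB) /(subsetP (sub_mclosure B)).
have xC : x \notin C by apply: contra xA; apply: (subsetP sC).
have ixC : indep M (x |: C).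
  apply: flat_extend (mclosure_flat B) iC _ xB.
  exact: subset_trans sC (subset_trans sAB (sub_mclosure B)).
have := indep_leq_rank ixC (setUS [set x] sC); rewrite cardsU1 xC rC inE; lia.
Qed.
End Matroid.

(** * Restricting forms to the fan *)

Section Forms.
Context {N : nat}.
Implicit Types (u : dualV0 N) (v : lattV N) (i j c : 'I_N.+1).

Definition diffF i j : lattW0 N :=
  Sub (vecF i - vecF j) (introT (gensubP _ _) (generated_mem
    (ex_intro _ i (ex_intro _ j erefl) : (fun w => exists i j, w = vecF i - vecF j) _))).

Definition gform i : dualV0 N := dualW0 (diffF i ord0).

Lemma gformE i v : gform i (classV0 v) = v 0 i - v 0 ord0.
Proof.
rewrite /gform dualW0E /dualpair /=.
under eq_bigr => k _ do rewrite !mxE !eqxx /= mulrBl.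
rewrite sumrB (bigD1 i) //= big1 => [|k /negPf ->]; last by rewrite mul0r.
rewrite (bigD1 ord0) //= big1 => [|k /negPf ->]; last by rewrite mul0r.
by rewrite !eqxx !mul1r !addr0.
Qed.

Lemma gform0 : gform ord0 = 0.
Proof. by apply/lfunP => x; rewrite -(reprV0K x) gformE subrr lfunE. Qed.

(** The identification of W_0 with the dual of V_0, preceded by the retraction of W
    onto W_0 that sends f_i to f_i - f_0: the ideal lives in the exterior algebra of
    the whole of W. *)
Definition proj_form (w : lattW N) : dualV0 N := \sum_i w 0 i *: gform i.

Lemma proj_form_linear : linear proj_form.
Proof.
move=> a w w'; rewrite /proj_form scaler_sumr -big_split; apply: eq_bigr => i _.
by rewrite !mxE scalerDl scalerA.
Qed.

HB.instance Definition _ :=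
  GRing.isLinear.Build int (lattW N) (dualV0 N) _ proj_form proj_form_linear.

Lemma proj_form_dualW0 (w : lattW0 N) : proj_form (val w) = dualW0 w.
Proof.
apply/lfunP => x; rewrite -(reprV0K x) dualW0E sum_lfunE.
transitivity (\sum_i val w 0 i * (reprV0 x 0 i - reprV0 x 0 ord0)).
  by apply: eq_bigr => i _; rewrite lfunE /= gformE.
under eq_bigr => i _ do rewrite mulrBr.
by rewrite sumrB -mulr_suml sum_lattW0 mul0r subr0.
Qed.

Lemma proj_form_vecF i : proj_form (vecF i) = gform i.
Proof.
rewrite /proj_form (bigD1 i) //= big1 => [|j /negPf ne]; rewrite mxE eqxx /=.
  by rewrite eqxx scale1r addr0.
by rewrite ne scale0r.
Qed.

Lemma proj_form_ext_sq w : (ext_vec \o proj_form) w * (ext_vec \o proj_form) w = 0.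
Proof. exact: ext_vec_sq. Qed.

Definition ext_proj : ext (lattW N) -> ext (dualV0 N) := ext_lift (ext_vec \o proj_form).

HB.instance Definition _ := GRing.Linear.on ext_proj.

Lemma ext_proj_wedge ws : ext_proj (wedge ws) = wedge (map proj_form ws).
Proof. by rewrite /ext_proj ext_lift_wedge; [rewrite /wedge big_map | exact: proj_form_ext_sq]. Qed.

Lemma ext_projM x y : ext_proj (x * y) = ext_proj x * ext_proj y.
Proof. exact: ext_liftM proj_form_ext_sq _ _. Qed.

Lemma ext_proj1 : ext_proj 1 = 1.
Proof. exact: ext_lift1 proj_form_ext_sq. Qed.

Lemma ext_proj_wedgeW0 (ws : seq (lattW0 N)) :
  ext_proj (val (wedgeW0 ws)) = wedge [seq dualW0 w | w <- ws].
Proof.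
rewrite ext_proj_wedge -map_comp; congr wedge; apply: eq_map => w /=.
exact: proj_form_dualW0.
Qed.

(** The preimage of a form has its values on the e_i as coordinates; they sum to zero
    because the sum of the e_i is zero in V_0. *)
Lemma dualW0_surj u : exists w : lattW0 N, dualW0 w = u.
Proof.
exists (\sum_i diffF i ord0 *~ u (classV0 (vecE i))); apply/lfunP => x.
rewrite -(reprV0K x); set v := reprV0 x.
rewrite -proj_form_dualW0 raddf_sum.
have -> : (\sum_i val (diffF i ord0 *~ u (classV0 (vecE i))) : lattW N) =
  \sum_i u (classV0 (vecE i)) *: (vecF i - vecF ord0).
  by apply: eq_bigr => i _; rewrite raddfMz /= -scaler_int intz.
rewrite linear_sum sum_lfunE.
transitivity (\sum_i u (classV0 (vecE i)) * (v 0 i - v 0 ord0)).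
  apply: eq_bigr => i _; rewrite linearZ linearB /= !proj_form_vecF gform0 subr0 lfunE /=.
  by rewrite gformE.
under eq_bigr => i _ do rewrite mulrBr.
have vE : v = \sum_i v 0 i *: vecE i by exact: row_sum_delta.
rewrite sumrB -mulr_suml [in RHS]vE.
have diag0 : classV0 (\sum_i vecE i) = 0 :> lattV0 N.
  rewrite -(raddf0 (@classV0 N)); apply/classV0P; rewrite subr0.
  by apply/gensubP; apply: generated_mem.
have -> : \sum_i u (classV0 (vecE i)) = 0.
  transitivity (u (classV0 (\sum_i vecE i))); last by rewrite diag0 linear0.
  by rewrite raddf_sum linear_sum.
rewrite mul0r subr0 raddf_sum linear_sum; apply: eq_bigr => i _.
by rewrite -[v 0 i]intz scaler_int raddfMz -scaler_int intz linearZ mulrC.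
Qed.
End Forms.

Section Cones.
Context (R : realType) {N : nat}.

(** Extending [u] to real scalars turns the rational spans into linear algebra over
    the reals. *)
Lemma cone_lattice_vanish (u : dualV0 N) (Js : seq {set 'I_N.+1}) (v : lattV0 N) :
  (forall J, J \in Js -> u (vecJ J) = 0) ->
  cone_lattice (conic_hull [seq realify R (vecJ J) | J <- Js]) v -> u v = 0.
Proof.
move=> uJ; pose uR (y : @V0real R N) : R := \sum_k y 0 k * (u (basis_vec k))%:~R.
have uR_real x : uR (realify R x) = (u x : int)%:~R.
  rewrite {2}(basis_expansion x) linear_sum rmorph_sum; apply: eq_bigr => k _.
  by rewrite linearZ /= mxE -rmorphM.
have uR_comb (I : finType) (a : I -> R) (f : I -> @V0real R N) :
    (forall i, uR (f i) = 0) -> uR (\sum_i a i *: f i) = 0.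
  move=> f0; transitivity (\sum_i a i * uR (f i)); last first.
    by rewrite big1 // => i _; rewrite f0 mulr0.
  under [RHS]eq_bigr => i _ do rewrite mulr_sumr.
  rewrite exchange_big; apply: eq_bigr => k _; rewrite summxE mulr_suml.
  by apply: eq_bigr => i _; rewrite !mxE mulrA.
move=> [s [a [sE vE]]]; apply/eqP; rewrite -(intr_eq0 R) -uR_real vE; apply/eqP.
apply: (uR_comb) => i; have [b _ ->] := sE _ (mem_nth 0 (ltn_ord i)).
apply: uR_comb => j; rewrite (nth_map set0) -?(size_map (fun J => realify R (vecJ J))) //.
by rewrite uR_real uJ // mem_nth // -(size_map (fun J => realify R (vecJ J))).
Qed.
End Cones.

(** * The Orlik-Solomon ideal restricts to zero *)

Section Boundary.
Context {N : nat}.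
Implicit Types (i c t : 'I_N.+1) (s : seq 'I_N.+1).

Lemma ext_vec_anticomm (R : comNzRingType) (V : vectType R) (v w : V) :
  ext_vec v * ext_vec w = - (ext_vec w * ext_vec v).
Proof.
apply/eqP; rewrite -addr_eq0; apply/eqP; have := ext_vec_sq (v + w).
by rewrite raddfD /= mulrDl !mulrDr !ext_vec_sq addr0 add0r.
Qed.

Lemma mul_diff_square_zero (A : pzRingType) (a b x y : A) :
  a * b = - (b * a) -> b * b = 0 -> (a - b) * (x - b * y) = a * x - b * (x - a * y).
Proof.
move=> ab bb; rewrite mulrBl !mulrBr !mulrA ab bb mul0r subr0 mulNr opprK opprB.
by rewrite addrA.
Qed.

Definition wedge_boundary (R : comNzRingType) (V : vectType R) (us : seq V) : ext V :=
  \sum_(k < size us) (-1) ^+ k * wedge (take k us ++ drop k.+1 us).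

Lemma wedge_boundary_cons (R : comNzRingType) (V : vectType R) (v : V) us :
  wedge_boundary (v :: us) = wedge us - ext_vec v * wedge_boundary us.
Proof.
rewrite /wedge_boundary /= big_ord_recl /= expr0 mul1r drop0; congr (_ + _).
rewrite mulr_sumr -sumrN; apply: eq_bigr => k _; rewrite /= wedge_cons /bump /= add1n exprS.
by rewrite mulN1r mulNr [in RHS]mulrA commr_sign mulrA.
Qed.

(** In the expanded product only the terms with at most one factor [v] survive, as the
    square of [v] is zero. *)
Lemma wedge_diff (R : comNzRingType) (V : vectType R) (v : V) us :
  wedge [seq u - v | u <- us] = wedge us - ext_vec v * wedge_boundary us.
Proof.
elim: us => [|u us IH]; first by rewrite /wedge_boundary big_ord0 mulr0 subr0.
rewrite /= wedge_cons IH wedge_boundary_cons wedge_cons raddfB /=.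
apply: mul_diff_square_zero; [exact: ext_vec_anticomm | exact: ext_vec_sq].
Qed.

Lemma OS_boundary_prod c s :
  OS_boundary (c :: s) = wedge [seq vecF t - vecF c | t <- s].
Proof.
rewrite [RHS](_ : _ = wedge [seq u - vecF c | u <- map (@vecF N) s]); last first.
  by rewrite -map_comp.
rewrite wedge_diff -wedge_boundary_cons /OS_boundary /wedge_boundary /= size_map.
by apply: eq_bigr => k _; rewrite map_cat map_take map_drop.
Qed.

Lemma gform_vecJ i (J : {set 'I_N.+1}) :
  gform i (vecJ J) = (i \in J)%:R - (ord0 \in J)%:R.
Proof.
have vJ k : (\sum_(j in J) vecE j : lattV N) 0 k = (k \in J)%:R.
  rewrite summxE; case: (boolP (k \in J)) => kJ.
    rewrite (bigD1 k) //= big1 => [|j /andP[_ /negPf ne]]; first by rewrite mxE !eqxx addr0.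
    by rewrite mxE eq_sym ne andbF.
  rewrite big1 // => j jJ; rewrite mxE; case: eqP => // jk.
  by case: eqP => // kj; rewrite kj jJ in kJ.
by rewrite /vecJ gformE !vJ.
Qed.
End Boundary.

Section Vanishing.
Context (R : realType) {N : nat} (M : matroid 'I_N.+1).
Hypothesis loopM : loopless M.

Lemma dependent_unseparated (C : {set 'I_N.+1}) Js : flag M Js -> ~~ indep M C ->
  exists p q, [/\ p \in C, q \in C, p != q & forall J, J \in Js -> (p \in J) = (q \in J)].
Proof.
move=> flagJs; apply: contraNP => noPQ; apply: (flag_separated_indep loopM flagJs).
move=> p q pC qC eqpq; apply/eqP; apply: contraT => npq.
by case: noPQ; exists p, q.
Qed.

(** Two elements of [s] that the flag does not separate give the same form on the
    cone, so the product of differences has a zero factor or two equal factors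
    there. *)
Lemma boundary_vanish Js s (vs : seq (lattV0 N)) (a b : ext (lattW N)) :
  flag M Js -> ~~ indep M [set i in s] ->
  (forall v, v \in vs -> cone_lattice (conic_hull [seq realify R (vecJ J) | J <- Js]) v) ->
  pairing (ext_proj (a * OS_boundary s * b)) (wedge vs) = 0.
Proof.
move=> flagJs dep vsJs.
have [p [q [pC qC npq sepJ]]] := dependent_unseparated flagJs dep.
have eqpq v : v \in vs -> gform p v = gform q v.
  move=> /vsJs vJs; apply/eqP; rewrite -subr_eq0; apply/eqP.
  have := @cone_lattice_vanish R N (gform p - gform q) Js v; rewrite !lfunE /= lfunE /=.
  apply=> // J JJs; rewrite !lfunE /= lfunE /= !gform_vecJ sepJ //; exact: subrr.
case: s pC qC dep => [|c s]; rewrite !inE //= => pC qC _.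
rewrite OS_boundary_prod !ext_projM ext_proj_wedge -map_comp.
apply: pairing_mul_wedge => A B; set us := map _ s.
have usE t v : (proj_form (vecF t - vecF c)) v = gform t v - gform c v.
  by rewrite linearB /= !proj_form_vecF !lfunE /= lfunE.
have mem_us t : t \in s -> proj_form (vecF t - vecF c) \in A ++ us ++ B.
  by move=> ts; rewrite !mem_cat (map_f (_ \o _) ts) orbT.
(* if [p] or [q] is the base point [c] of the differences, a row is zero; otherwise
   the rows of [p] and [q] are equal *)
case: (eqVneq p c) pC => [pc _|npc /= ps].
  have qs : q \in s by move: qC; rewrite -pc eq_sym (negPf npq).
  apply: det_pairing_zero_row (mem_us _ qs) _ => v /eqpq.
  by rewrite usE -pc => ->; rewrite subrr.
case: (eqVneq q c) qC => [qc _|nqc /= qs].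
  apply: det_pairing_zero_row (mem_us _ ps) _ => v /eqpq.
  by rewrite usE -qc => ->; rewrite subrr.
have pos t : t \in s -> (size A + index t s < size (A ++ us ++ B))%N /\
    (A ++ us ++ B)`_(size A + index t s) = proj_form (vecF t - vecF c).
  move=> ts; have lt_ts : (index t s < size s)%N by rewrite index_mem.
  rewrite !size_cat size_map ltn_add2l ltn_addr //; split=> //.
  rewrite nth_cat ltnNge leq_addr /= addKn nth_cat size_map lt_ts.
  by rewrite (nth_map c) // nth_index.
have [ltp Ep] := pos p ps; have [ltq Eq] := pos q qs.
apply: (det_pairing_equal_rows _ ltp ltq) => [|v /eqpq].
  by rewrite eqn_add2l; apply: contra npq => /eqP eqi; rewrite -(nth_index c ps) eqi nth_index.
by rewrite Ep Eq !usE => ->.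
Qed.

Lemma OS_ideal_vanish (x : ext (lattW N)) k (z : ext (lattV0 N)) :
  x \in OS_ideal M -> z \in in_tropF R M k -> pairing (ext_proj x) z = 0.
Proof.
move=> /gensubP Ix /gensubP Fz; move: x Ix.
apply: generated_min => [|x y xz yz|x xz|_ [a [s [b [us dep ->]]]]].
- by rewrite raddf0 pairing0l.
- by rewrite raddfD pairingDl xz yz addr0.
- by rewrite raddfN pairingNl xz oppr0.
move: z Fz; apply: generated_min => [|x y xz yz|x xz|_ [_ [Js flagJs ->] [vs [vsJs ->]]]].
- exact: pairing0r.
- by rewrite pairingDr xz yz addr0.
- by rewrite -sub0r pairingBr xz pairing0r subr0.
apply: boundary_vanish flagJs dep _ => v /tnthP[i ->]; exact: vsJs.
Qed.
End Vanishing.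

(** * Sets without broken circuits *)

Lemma sign_scale (R : comNzRingType) (A : lalgType R) k (x : A) :
  (-1) ^+ k * x = (-1) ^+ k *: x.
Proof.
rewrite -signr_odd -[in RHS]signr_odd; case: odd.
  by rewrite !expr1 mulN1r scaleN1r.
by rewrite !expr0 mul1r scale1r.
Qed.

Section BrokenCircuits.
Context (R : realType) {N : nat} (M : matroid 'I_N.+1).
Notation E := 'I_N.+1.
Implicit Types (S T J : {set E}) (i j t : E).

Definition upper S i : {set E} := [set t in S | (i <= t)%N].
Definition upper_flat S i : {set E} := mclosure M (upper S i).

(** A broken circuit is a circuit deprived of its least element; in a loopless matroid
    [S] contains one exactly if, for some [i] in [S], a smaller [j] lies in the closure
    of the elements of [S] from [i] on.  Leaving out the sets that contain 0 selects
    the basis of the projective algebra among that of the whole Orlik-Solomon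
    algebra. *)
Definition nbc S : bool :=
  (ord0 \notin S) && [forall i in S, forall j : E, (j < i)%N ==> (j \notin upper_flat S i)].

Definition nbc_chain S : seq (lattV0 N) := [seq vecJ (upper_flat S i) | i <- enum S].
Definition nbc_forms T : seq (dualV0 N) := map gform (enum T).

Lemma nbc_gt0 S i : nbc S -> i \in S -> (0 < i)%N.
Proof.
case/andP=> S0 _ iS; rewrite lt0n; apply: contra S0 => /eqP i0.
by rewrite (_ : ord0 = i) //; apply: val_inj.
Qed.

Lemma mem_upper_flat S i : i \in S -> i \in upper_flat S i.
Proof. by move=> iS; apply: (subsetP (sub_mclosure _ _)); rewrite inE iS leqnn. Qed.

Lemma upper_flat_min S i j : nbc S -> i \in S -> j \in upper_flat S i -> (i <= j)%N.
Proof.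
case/andP=> _ /forall_inP nbcS iS jJ; rewrite leqNgt; apply: contraL jJ => ji.
by have /forallP/(_ j)/implyP := nbcS _ iS; apply.
Qed.

Lemma sub_upper_flat S i j : (i <= j)%N -> upper_flat S j \subset upper_flat S i.
Proof.
move=> ij; apply: mclosureS; apply/subsetP => t; rewrite !inE => /andP[-> /=].
exact: leq_trans.
Qed.

Lemma ord0_upper_flat S i : nbc S -> i \in S -> ord0 \notin upper_flat S i.
Proof.
by move=> nbcS iS; apply/negP => /(upper_flat_min nbcS iS); rewrite leqNgt (nbc_gt0 nbcS).
Qed.

Lemma enum_sorted S : sorted (fun i j : E => (i < j)%N) (enum S).
Proof.
have -> : enum S = [seq i <- enum E | i \in S] by rewrite [enum E]enumT.
apply: sorted_filter => [j i k|]; first exact: ltn_trans.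
have := iota_ltn_sorted 0 N.+1; rewrite -val_enum_ord sorted_map; exact: id.
Qed.

Lemma nbc_flag S : nbc S -> flag M (rev (map (upper_flat S) (enum S))).
Proof.
move=> nbcS; apply/andP; split.
  rewrite all_rev all_map; apply/allP => i; rewrite mem_enum => iS /=.
  apply/and3P; split; first exact: mclosure_flat.
    by apply/set0Pn; exists i; apply: mem_upper_flat.
  by apply: contraNneq (ord0_upper_flat nbcS iS) => ->; rewrite inE.
rewrite rev_sorted sorted_map.
apply: (@sub_in_sorted _ (mem (enum S))) (enum_sorted S); last exact/allP.
move=> i j; rewrite !mem_enum => iS jS ij /=.
rewrite properE sub_upper_flat ?(ltnW ij) //=; apply/subsetPn; exists i.
  exact: mem_upper_flat.
by apply/negP => /(upper_flat_min nbcS jS); rewrite leqNgt ij.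
Qed.

Lemma cone_lattice_ray (Js : seq {set E}) J : J \in Js ->
  cone_lattice (conic_hull [seq realify R (vecJ J) | J <- Js]) (vecJ J).
Proof.
move=> JJs; set s := [seq _ | _ <- _].
have Js_s : realify R (vecJ J) \in s by apply: (map_f (fun J => realify R (vecJ J))).
have lt_J : (index (realify R (vecJ J)) s < size s)%N by rewrite index_mem.
exists [:: realify R (vecJ J)], (fun=> 1); split; last by rewrite big_ord1 scale1r.
move=> y; rewrite inE => /eqP ->.
exists (fun k => (k == Ordinal lt_J)%:R) => [k|]; first by rewrite ler0n.
rewrite (bigD1 (Ordinal lt_J)) //= big1 => [|i /negPf ->]; last by rewrite scale0r.
by rewrite eqxx scale1r addr0 nth_index.
Qed.

Lemma nbc_chain_tropF S : nbc S -> wedge (nbc_chain S) \in in_tropF R M #|S|.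
Proof.
move=> nbcS; apply/gensubP; apply: generated_mem.
exists (conic_hull [seq realify R (vecJ J) | J <- rev (map (upper_flat S) (enum S))]).
  by exists (rev (map (upper_flat S) (enum S))); first exact: nbc_flag.
have sz : size (nbc_chain S) == #|S| by rewrite size_map -cardE.
exists (Tuple sz); split=> // k; have : tnth (Tuple sz) k \in nbc_chain S by apply: mem_tnth.
move=> /mapP[i iS ->]; apply: cone_lattice_ray.
by rewrite mem_rev; apply: map_f.
Qed.

Lemma enum_sum (U : {set E}) k : #|U| = k ->
  (\sum_(i in U) i = \sum_(a < k) nth ord0 (enum U) a)%N.
Proof. by move=> <-; rewrite -big_enum /= (big_nth ord0) -cardE big_mkord. Qed.

Section Incidence.
Variables S T : {set E}.
Hypotheses (nbcS : nbc S) (cardST : #|T| = #|S|).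

Let s_ (a : 'I_#|S|) : E := nth ord0 (enum S) a.
Let t_ (a : 'I_#|S|) : E := nth ord0 (enum T) a.

Lemma nbc_pairing_det :
  det_pairing (nbc_forms T) (nbc_chain S) =
  \det (\matrix_(a < #|S|, b < #|S|) (t_ a \in upper_flat S (s_ b))%:R : 'M[int]_#|S|).
Proof.
rewrite (@det_pairing_sized _ _ #|S|) ?size_map -?cardE //; congr (\det _).
apply/matrixP => a b; rewrite !mxE !(nth_map ord0) -?cardE ?cardST //.
rewrite gform_vecJ (negPf (ord0_upper_flat nbcS _)) ?subr0 //.
by rewrite -mem_enum mem_nth // -cardE.
Qed.

(** A nonzero term of the determinant matches the elements of [T] with those of [S],
    each being at least its partner. *)
Lemma nbc_pairing_sum :
  det_pairing (nbc_forms T) (nbc_chain S) != 0 ->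
  T = S \/ (\sum_(i in S) i < \sum_(i in T) i)%N.
Proof.
rewrite nbc_pairing_det => det_neq0.
have [sg sgP] : exists sg : 'S_#|S|, forall a, t_ a \in upper_flat S (s_ (sg a)).
  apply: contrapT => no_sg; case/eqP: det_neq0; rewrite /determinant big1 // => sg _.
  have [a tN] : exists a, t_ a \notin upper_flat S (s_ (sg a)).
    apply: contrapT => no_a; apply: no_sg; exists sg => a.
    by apply/negPn/negP => tN; apply: no_a; exists a.
  by rewrite (bigD1 a) //= mxE (negPf tN) mul0r mulr0.
have sS b : s_ b \in S by rewrite -mem_enum mem_nth // -cardE.
have le_st a : (s_ (sg a) <= t_ a)%N by apply: upper_flat_min (sgP a).
have [|neTS] := eqVneq T S; [by left | right].
have /subsetPn[t tT tS] : ~~ (T \subset S).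
  by apply: contra neTS => sTS; rewrite eqEcard sTS cardST leqnn.
have lt_t : (index t (enum T) < #|S|)%N by rewrite -cardST cardE index_mem mem_enum.
pose a := Ordinal lt_t.
have ta : t_ a = t by rewrite /t_ nth_index // mem_enum.
rewrite (enum_sum (erefl #|S|)) (enum_sum cardST) (reindex_inj (@perm_inj _ sg)) /=.
rewrite (bigD1 a) //= [X in (_ < X)%N](bigD1 a) //= -addSn leq_add //; last first.
  by apply: leq_sum => b _; apply: le_st.
rewrite ltn_neqAle le_st andbT; apply: contra tS => /eqP eq_st.
by rewrite -ta (_ : t_ a = s_ (sg a)) //; apply: val_inj.
Qed.
End Incidence.

(** The incidence matrix of [S] with its own flats is triangular, because an element
    is the least one of its flat. *)
Lemma nbc_pairing_diag S : nbc S -> det_pairing (nbc_forms S) (nbc_chain S) = 1.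
Proof.
move=> nbcS; rewrite nbc_pairing_det //.
have sS (b : 'I_#|S|) : nth ord0 (enum S) b \in S by rewrite -mem_enum mem_nth // -cardE.
rewrite det_trig; first by rewrite big1 // => a _; rewrite mxE mem_upper_flat.
apply/is_trig_mxP => a b ab; rewrite mxE.
case: (boolP (_ \in _)) => // /(upper_flat_min nbcS (sS b)).
rewrite leqNgt => /negP[].
have := enum_sorted S; rewrite sorted_pairwise; last by move=> j i k; apply: ltn_trans.
by move=> /(pairwiseP ord0) -> //; rewrite inE -cardE.
Qed.

Lemma nbc_triangular S T : nbc S ->
  det_pairing (nbc_forms T) (nbc_chain S) != 0 ->
  T = S \/ (\sum_(i in S) i < \sum_(i in T) i)%N.
Proof.
move=> nbcS; case: (eqVneq #|T| #|S|) => [cST|neST]; first exact: nbc_pairing_sum.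
by rewrite det_pairing_neq ?eqxx // !size_map -!cardE.
Qed.

Definition gvec t : lattW N := vecF t - vecF ord0.

Definition nbc_spanned (x : ext (lattW N)) : Prop :=
  exists c : {set E} -> int,
    x - \sum_(S | nbc S) c S *: wedge (map gvec (enum S)) \in OS_ideal M.

Lemma OS_idealZ a x : x \in OS_ideal M -> a *: x \in OS_ideal M.
Proof. by move=> Ix; rewrite -[x]mul1r scalerAl OS_ideal_mull. Qed.

Lemma nbc_spanned_ideal x : x \in OS_ideal M -> nbc_spanned x.
Proof.
by move=> Ix; exists (fun=> 0); rewrite big1 ?subr0 // => S _; rewrite scale0r.
Qed.

Lemma nbc_spanned_basis S : nbc S -> nbc_spanned (wedge (map gvec (enum S))).
Proof.
move=> nbcS; exists (fun T => (T == S)%:R).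
rewrite (bigD1 S) //= big1 => [|T /andP[_ /negPf ->]]; last by rewrite scale0r.
by rewrite eqxx scale1r addr0 subrr rpred0.
Qed.

Lemma nbc_spannedP a x y : nbc_spanned x -> nbc_spanned y -> nbc_spanned (a *: x + y).
Proof.
move=> [c cx] [d dy]; exists (fun S => a * c S + d S).
under eq_bigr => S _ do rewrite scalerDl -scalerA.
rewrite big_split /= -scaler_sumr opprD addrACA -scalerBr.
by apply: rpredD dy; apply: OS_idealZ.
Qed.

Lemma nbc_spanned0 : nbc_spanned 0.
Proof. by apply: nbc_spanned_ideal; apply: rpred0. Qed.

Lemma nbc_spannedZ a x : nbc_spanned x -> nbc_spanned (a *: x).
Proof. by move=> sx; rewrite -[_ *: _]addr0; apply: nbc_spannedP sx nbc_spanned0. Qed.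

Lemma nbc_spannedD x y : nbc_spanned x -> nbc_spanned y -> nbc_spanned (x + y).
Proof. by move=> sx sy; rewrite -[x]scale1r; apply: nbc_spannedP. Qed.

Lemma nbc_spannedN x : nbc_spanned x -> nbc_spanned (- x).
Proof. by move=> sx; rewrite -scaleN1r; apply: nbc_spannedZ. Qed.

Lemma nbc_spanned_perm (us vs : seq (lattW N)) : perm_eq us vs ->
  nbc_spanned (wedge us) -> nbc_spanned (wedge vs).
Proof.
move=> /(alternating_perm (@wedge_multilinear _ _) (@wedge_alternating _ _)) [] -> //.
exact: nbc_spannedN.
Qed.

Lemma not_nbc S : ord0 \notin S -> ~~ nbc S ->
  exists i j, [/\ i \in S, (j < i)%N & j \in upper_flat S i].
Proof.
rewrite /nbc => -> /=; rewrite negb_forall_in => /exists_inP[i iS].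
rewrite negb_forall => /existsP[j]; rewrite negb_imply negbK => /andP[ji jJ].
by exists i, j.
Qed.

(** When [j < i] lies in the closure of the elements of [s] from [i] on, the boundary
    of the resulting dependent set rewrites their product, modulo the ideal, into
    products where [j] replaces one of them; the sum of the indices drops. *)
Lemma nbc_spanned_list (s : seq E) : nbc_spanned (wedge (map gvec s)).
Proof.
have [m] := ubnP (sumn (map (@nat_of_ord N.+1) s)); elim: m s => // m IH s ltm.
case: (boolP (uniq s)) => [us|nus]; last first.
  rewrite (alternating_not_uniq (@wedge_multilinear _ _) (@wedge_alternating _ _)).
    exact: nbc_spanned0.
  by apply: contra nus; apply: map_uniq.
case: (boolP (ord0 \in s)) => [s0|s0].
  have /(perm_map gvec) : perm_eq (ord0 :: rem ord0 s) s by rewrite perm_sym perm_to_rem.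
  move=> /nbc_spanned_perm; apply.
  by rewrite /= wedge_cons /gvec subrr raddf0 mul0r; apply: nbc_spanned0.
pose S := [set t in s].
have sS : perm_eq (enum S) s.
  by apply: uniq_perm => // [|t]; rewrite ?enum_uniq // mem_enum inE.
case: (boolP (nbc S)) => [nbcS|]; first exact: nbc_spanned_perm (perm_map _ sS) (nbc_spanned_basis nbcS).
case/not_nbc=> [|i [j [iS ji jJ]]]; first by rewrite inE.
(* [j] is to replace one of the elements of [U] *)
pose U := enum (upper S i); pose L := enum (S :\: upper S i).
have UL : perm_eq (U ++ L) s.
  apply: perm_trans sS; apply: uniq_perm; rewrite ?enum_uniq //.
    rewrite cat_uniq !enum_uniq andbT /=; apply/hasPn => t; rewrite mem_enum => /setDP[_ tU].
    by rewrite /= mem_enum.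
  move=> t; rewrite mem_cat !mem_enum in_setD; case: (boolP (t \in upper S i)) => //=.
  by rewrite inE => /andP[-> _].
apply: (nbc_spanned_perm (perm_map gvec UL)); rewrite map_cat wedge_cat.
have -> : wedge (map gvec U) =
    wedge [seq vecF t - vecF j | t <- U] + ext_vec (gvec j) * wedge_boundary (map gvec U).
  have -> : [seq vecF t - vecF j | t <- U] = [seq u - gvec j | u <- map gvec U].
    by rewrite -map_comp; apply: eq_map => t; rewrite /= /gvec opprB addrA subrK.
  by rewrite wedge_diff subrK.
rewrite mulrDl; apply: nbc_spannedD.
  rewrite -OS_boundary_prod; apply: nbc_spanned_ideal; apply: OS_ideal_mulr.
  have jU : j \notin upper S i by rewrite inE leqNgt ji andbF.
  apply/gensubP; apply: generated_mem; exists 1, (j :: U), 1; rewrite mul1r mulr1; split=> //.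
    by rewrite /= mem_enum jU enum_uniq.
  have -> : [set t in j :: U] = j |: upper S i.
    by apply/setP => t; rewrite in_setU1 inE in_cons mem_enum.
  exact: mclosure_dep.
rewrite /wedge_boundary mulr_sumr mulr_suml; apply: big_ind => [||k _].
- exact: nbc_spanned0.
- exact: nbc_spannedD.
rewrite sign_scale -scalerAr -scalerAl; apply: nbc_spannedZ.
rewrite -wedge_cons -wedge_cat -map_take -map_drop -map_cat -map_cons -map_cat.
apply: IH; move: ltm; rewrite -(perm_sumn (perm_map (@nat_of_ord N.+1) UL)) ltnS; apply: leq_trans.
have ltk : (k < size U)%N by rewrite -(size_map gvec).
have jUk : (j < nth ord0 U k)%N.
  have : nth ord0 U k \in upper S i by rewrite -mem_enum mem_nth.
  by rewrite inE => /andP[_]; apply: leq_trans.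
rewrite /= -[X in (_ < sumn (map _ (X ++ _)))%N](cat_take_drop k U) (drop_nth ord0 ltk).
rewrite !map_cat !sumn_cat /= [(sumn _ + (_ + _))%N]addnCA.
by rewrite -[X in (_ < X)%N]addnA ltn_add2r.
Qed.

Lemma extW0_spanned x : x \in @in_extW0 N -> nbc_spanned x.
Proof.
move=> /gensubP; move: x; apply: generated_min => [||x|_ [ws ->]].
- exact: nbc_spanned0.
- exact: nbc_spannedD.
- exact: nbc_spannedN.
suff H s : nbc_spanned (wedge (map gvec s ++ map val ws)) by apply: (H [::]).
elim: ws s => [|w ws IH] s; first by rewrite cats0; apply: nbc_spanned_list.
have -> : map val (w :: ws) = (\sum_t val w 0 t *: gvec t) :: map val ws.
  congr (_ :: _); rewrite /gvec.
  under eq_bigr => t _ do rewrite scalerBr.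
  rewrite sumrB -scaler_suml sum_lattW0 scale0r subr0; exact: row_sum_delta.
rewrite (multilinear_sum (@wedge_multilinear _ _)).
apply: big_ind => [||t _]; [exact: nbc_spanned0 | exact: nbc_spannedD |].
by apply: nbc_spannedZ; rewrite -cat_rcons -map_rcons; apply: IH.
Qed.
End BrokenCircuits.

(** * Solving the triangular system *)

(** Row [i] only involves columns of larger weight, so the unknowns can be found one
    by one, a row of least weight coming last. *)
Lemma unitriangular_solve (I : finType) (P : pred I) (A : I -> I -> int) (wt : I -> nat)
    (t : I -> int) :
  (forall i, P i -> A i i = 1) ->
  (forall i j, P i -> P j -> A i j != 0 -> i = j \/ (wt i < wt j)%N) ->
  exists c : I -> int, forall i, P i -> \sum_(j | P j) A i j * c j = t i.
Proof.
have [m] := ubnP #|P|; elim: m P => // m IH P ltm diagA triA.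
have [i1 Pi1|P0] := pickP P.
  case: (arg_minnP wt Pi1) => i0 Pi0 min_i0.
  pose P' := [pred i | P i && (i != i0)].
  have [|i /andP[Pi _]|i j /andP[Pi _] /andP[Pj _]|c cP] := IH P'.
  - by move: ltm; rewrite ltnS (cardD1 i0) unfold_in Pi0; apply: leq_trans; rewrite add1n ltnS;
      apply: subset_leq_card; apply/subsetP => i; rewrite !inE andbC.
  - exact: diagA.
  - exact: triA.
  (* row [i0] is the only one to involve column [i0] *)
  exists (fun j => if j == i0 then t i0 - \sum_(j | P' j) A i0 j * c j else c j) => i Pi.
  rewrite (bigD1 i0) //= eqxx [X in _ + X = _](eq_bigr (fun j => A i j * c j)); last first.
    by move=> j /andP[_ /negPf ->].
  have [->|ne] := eqVneq i i0; first by rewrite diagA // mul1r subrK.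
  have -> : A i i0 = 0.
    apply/eqP; apply: contraT => /(triA i i0 Pi Pi0)[eqi|]; first by rewrite eqi eqxx in ne.
    by rewrite ltnNge min_i0.
  by rewrite mul0r add0r cP //= Pi.
by exists (fun=> 0) => i; rewrite P0.
Qed.

Lemma unitriangular_solve_tr (I : finType) (P : pred I) (A : I -> I -> int) (wt : I -> nat)
    (t : I -> int) :
  (forall i, P i -> A i i = 1) ->
  (forall i j, P i -> P j -> A i j != 0 -> i = j \/ (wt i < wt j)%N) ->
  exists c : I -> int, forall j, P j -> \sum_(i | P i) c i * A i j = t j.
Proof.
move=> diagA triA; pose b := (\max_i wt i)%N.
have le_b i : (wt i <= b)%N by rewrite /b (bigD1 i) //= leq_maxl.
have [|j i Pj Pi /triA [//|//|->|lt]|c cP] :=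
  @unitriangular_solve I P (fun i j => A j i) (fun i => (b - wt i)%N) t.
- exact: diagA.
- by left.
- by right; have := le_b i; have := le_b j; lia.
by exists c => j Pj; rewrite -(cP j Pj); apply: eq_bigr => i _; rewrite mulrC.
Qed.

(** The coefficient at [j] is the combination of the equations whose weights [d] solve
    the transposed system for the unit vector at [j]. *)
Lemma unitriangular_inj (I : finType) (P : pred I) (A : I -> I -> int) (wt : I -> nat)
    (c : I -> int) :
  (forall i, P i -> A i i = 1) ->
  (forall i j, P i -> P j -> A i j != 0 -> i = j \/ (wt i < wt j)%N) ->
  (forall i, P i -> \sum_(j | P j) A i j * c j = 0) -> forall j, P j -> c j = 0.
Proof.
move=> diagA triA c0 j Pj.
have [d dP] := unitriangular_solve_tr (fun k => (k == j)%:R) diagA triA.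
transitivity (\sum_(k | P k) (k == j)%:R * c k).
  rewrite (bigD1 j) //= eqxx mul1r big1 ?addr0 // => k /andP[_ /negPf ->].
  by rewrite mul0r.
transitivity (\sum_(k | P k) \sum_(i | P i) d i * A i k * c k).
  by apply: eq_bigr => k Pk; rewrite -dP // mulr_suml.
rewrite exchange_big big1 // => i Pi /=.
under eq_bigr => k _ do rewrite -mulrA.
by rewrite -mulr_sumr c0 ?mulr0.
Qed.

(** * The isomorphism *)

Section Isomorphism.
Context (R : realType) {N : nat} (M : matroid 'I_N.+1).
Hypothesis loopM : loopless M.
Notation E := 'I_N.+1.
Implicit Types (S T : {set E}) (om : ext (dualV0 N)).

Let nbc_form T : ext (lattW N) := wedge (map (@gvec N) (enum T)).
Let nbc_cycle S : ext (lattV0 N) := wedge (nbc_chain M S).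
Let wt S := (\sum_(i in S) i)%N.
Let entry S T : int := det_pairing (nbc_forms T) (nbc_chain M S).

Let nbc_cycleF S : nbc M S -> nbc_cycle S \in in_tropF R M #|S|.
Proof. exact: nbc_chain_tropF. Qed.

Let entry_diag S : nbc M S -> entry S S = 1.
Proof. exact: nbc_pairing_diag. Qed.

Let entry_triangular S T : nbc M S -> nbc M T -> entry S T != 0 -> S = T \/ (wt S < wt T)%N.
Proof. by move=> nbcS _ /(nbc_triangular nbcS)[->|]; [left | right]. Qed.

Lemma proj_form_gvec t : proj_form (gvec t : lattW N) = gform t.
Proof. by rewrite linearB /= !proj_form_vecF gform0 subr0. Qed.

Let ext_proj_nbc_form T : ext_proj (nbc_form T) = wedge (nbc_forms T).
Proof.
by rewrite ext_proj_wedge -map_comp; congr wedge; apply: eq_map => t; exact: proj_form_gvec.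
Qed.

Let homogeneous_nbc_form T : homogeneous #|T| (ext_proj (nbc_form T)).
Proof. by rewrite ext_proj_nbc_form => S /wedge_homogeneous; rewrite size_map -cardE. Qed.

Let pairing_nbc S T : pairing (ext_proj (nbc_form T)) (nbc_cycle S) = entry S T.
Proof. by rewrite ext_proj_nbc_form pairing_wedge. Qed.

Lemma wedge_gvec_extW0 (s : seq E) : wedge (map (@gvec N) s) \in @in_extW0 N.
Proof.
apply/gensubP; apply: generated_mem; exists [seq diffF t ord0 | t <- s].
by rewrite -map_comp.
Qed.

Lemma extW0Z a (x : ext (lattW N)) : x \in @in_extW0 N -> a *: x \in @in_extW0 N.
Proof. by move=> Wx; rewrite -[a]intz scaler_int rpredMz. Qed.

Lemma tropFZ k a (z : ext (lattV0 N)) : z \in in_tropF R M k -> a *: z \in in_tropF R M k.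
Proof. by move=> Fz; rewrite -[a]intz scaler_int rpredMz. Qed.

Lemma tropF_homogeneous k (z : ext (lattV0 N)) : z \in in_tropF R M k -> homogeneous k z.
Proof.
move=> /gensubP; move: z; apply: generated_min => [S|x y hx hy S|x hx S|_ [_ _ [vs [_ ->]]] S].
- by rewrite ffunE eqxx.
- rewrite ffunE; case: (eqVneq (x S) 0) => [->|/hx //].
  by rewrite add0r; apply: hy.
- by rewrite ffunE oppr_eq0; apply: hx.
by move=> /wedge_homogeneous; rewrite size_tuple.
Qed.

Lemma ext_proj_surj om : exists x : extW0 N, ext_proj (val x) = om.
Proof.
rewrite (ext_expansion om); apply: (big_ind (fun om => exists x : extW0 N, ext_proj (val x) = om)).
- by exists 0; rewrite !raddf0.
- by move=> _ _ [x <-] [y <-]; exists (x + y); rewrite !raddfD.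
move=> S _; have [ws wsE] : exists ws : seq (lattW0 N), basis_seq S = [seq dualW0 w | w <- ws].
  elim: (basis_seq S) => [|u us [ws ->]]; first by exists [::].
  by have [w <-] := dualW0_surj u; exists (w :: ws).
exists (wedgeW0 ws *~ om S).
transitivity (ext_proj (val (wedgeW0 ws)) *~ om S); first by rewrite !raddfMz.
by rewrite ext_proj_wedgeW0 -wsE -scaler_int intz.
Qed.

Lemma ext_projZ a (x : ext (lattW N)) : ext_proj (a *: x) = a *: ext_proj x.
Proof. by rewrite -[a]intz !scaler_int raddfMz. Qed.

Lemma pairing_ext_proj_sum (P : pred {set E}) c (F : {set E} -> ext (lattW N))
    (z : ext (lattV0 N)) :
  pairing (ext_proj (\sum_(T | P T) c T *: F T)) z =
  \sum_(T | P T) c T * pairing (ext_proj (F T)) z.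
Proof.
rewrite raddf_sum pairing_suml; apply: eq_bigr => T _.
by rewrite -pairingZl -ext_projZ.
Qed.

(** Subtracting a combination of the cycles makes all [nbc_form T] vanish on [z]; these
    span the forms modulo the ideal, which vanishes on [z] too, so nondegeneracy of
    the pairing leaves zero. *)
Lemma tropF_nbc_expansion k (z : ext (lattV0 N)) : z \in in_tropF R M k ->
  exists d : {set E} -> int, z = \sum_(S | nbc M S && (#|S| == k)) d S *: nbc_cycle S.
Proof.
move=> Fz; pose P S := nbc M S && (#|S| == k).
have [S /andP[nbcS _]|S T /andP[nbcS _] /andP[nbcT _]|d dP] :=
  @unitriangular_solve_tr _ P entry wt (fun T => pairing (ext_proj (nbc_form T)) z).
- exact: entry_diag.
- exact: entry_triangular.
exists d; apply/eqP; rewrite -subr_eq0; apply/eqP; set z' := _ - _.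
have Fz' : z' \in in_tropF R M k.
  apply: rpredB Fz _; apply: rpred_sum => S /andP[nbcS /eqP <-].
  exact/tropFZ/nbc_cycleF.
have hz' := tropF_homogeneous Fz'.
apply: pairing_nondegenerate => om; have [x <-] := ext_proj_surj om.
have [c Ic] := extW0_spanned M (valP x).
rewrite -[val x](subrK (\sum_(T | nbc M T) c T *: nbc_form T)) raddfD pairingDl.
rewrite (OS_ideal_vanish loopM Ic Fz') add0r pairing_ext_proj_sum big1 // => T nbcT.
case: (eqVneq #|T| k) => [Tk|neTk]; last first.
  by rewrite (pairing_homogeneous _ hz' neTk) ?mulr0 //; apply: homogeneous_nbc_form.
have PT : P T by rewrite /P nbcT Tk eqxx.
rewrite /z' pairingBr pairing_sumr -(dP T PT); apply/eqP; rewrite mulf_eq0 subr_eq0.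
apply/orP; right; apply/eqP; apply: eq_bigr => S _.
by rewrite pairingZr pairing_nbc.
Qed.

Lemma trop_coh_eq (alpha beta : trop_coh R M) :
  (forall k x, alpha k x = beta k x) -> alpha = beta.
Proof.
move=> eq_ab; apply: functional_extensionality_dep => k.
have {eq_ab} : (alpha k : tropF R M k -> int) = beta k by apply/funext => x.
case: (alpha k) => f [[Hf]]; case: (beta k) => g [[Hg]] /= fg; rewrite -fg in Hg *.
by rewrite (Prop_irrelevance Hf Hg).
Qed.

Lemma pairing_extW0B (x y : extW0 N) (z : ext (lattV0 N)) :
  pairing (ext_proj (val x)) z - pairing (ext_proj (val y)) z =
  pairing (ext_proj (val (x - y))) z.
Proof. by rewrite !raddfB pairingDl pairingNl. Qed.

Lemma trop_restrict_ideal (x y : extW0 N) : x - y \in OS_ideal0 M ->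
  trop_restrict R M (ext_proj (val x)) = trop_restrict R M (ext_proj (val y)).
Proof.
move=> Ixy; apply: trop_coh_eq => k z; rewrite /= /restrict_form.
apply/eqP; rewrite -subr_eq0 pairing_extW0B.
by rewrite (OS_ideal_vanish loopM Ixy (valP z)).
Qed.

(** Evaluated on the cycles, a form that restricts to zero gives a homogeneous
    triangular system for its coefficients on the [nbc_form T]. *)
Lemma trop_restrict_inj (x y : extW0 N) :
  trop_restrict R M (ext_proj (val x)) = trop_restrict R M (ext_proj (val y)) ->
  x - y \in OS_ideal0 M.
Proof.
move=> eq_xy; change (val (x - y) \in OS_ideal M).
have vanish k (z : ext (lattV0 N)) (Fz : z \in in_tropF R M k) :
    pairing (ext_proj (val (x - y))) z = 0.
  have : trop_restrict R M (ext_proj (val x)) k (exist _ z Fz) =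
    trop_restrict R M (ext_proj (val y)) k (exist _ z Fz) by rewrite eq_xy.
  rewrite /= /restrict_form /= => /eqP; rewrite -subr_eq0 pairing_extW0B.
  by move/eqP.
have [c Ic] := extW0_spanned M (valP (x - y)).
have c0 T : nbc M T -> c T = 0.
  move: T; apply: (unitriangular_inj entry_diag entry_triangular) => S nbcS.
  have Fcyc := nbc_cycleF nbcS.
  have := OS_ideal_vanish loopM Ic Fcyc.
  rewrite raddfB pairingDl pairingNl (vanish _ _ Fcyc) sub0r => /eqP; rewrite oppr_eq0 => /eqP pair0.
  by rewrite -[RHS]pair0 pairing_ext_proj_sum; apply: eq_bigr => T _; rewrite pairing_nbc mulrC.
have sum0 : \sum_(T | nbc M T) c T *: wedge [seq gvec i | i <- enum T] = 0 :> ext (lattW N).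
  by apply: big1 => T nbcT; rewrite (c0 T nbcT); apply: scale0r.
move: Ic; rewrite sum0 subr0; exact: id.
Qed.

(** The cycle as an element of the group F_k; for [k] other than the size of [S], this
    is the default value 0. *)
Let cycle_class k S : tropF R M k := insubd 0 (nbc_cycle S).

Let cycle_classE S : nbc M S -> val (cycle_class #|S| S) = nbc_cycle S.
Proof. by move=> nbcS; rewrite /cycle_class insubdK // nbc_cycleF. Qed.

Lemma pairing_sum_degree (P : pred {set E}) (c : {set E} -> int) k (z : ext (lattV0 N)) :
  homogeneous k z ->
  pairing (ext_proj (\sum_(T | P T) c T *: nbc_form T)) z =
  pairing (ext_proj (\sum_(T | P T && (#|T| == k)) c T *: nbc_form T)) z.
Proof.
move=> hz; rewrite [LHS]pairing_ext_proj_sum [RHS]pairing_ext_proj_sum.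
rewrite (bigID (fun T : {set E} => #|T| == k)) /=.
rewrite [X in _ + X]big1 ?addr0 // => T /andP[_ neTk].
by rewrite (pairing_homogeneous _ hz neTk) ?mulr0 //; apply: homogeneous_nbc_form.
Qed.

(** Both sides of the asserted equality are additive, so it is enough to compare
    them on the cycles of the sets without broken circuits. *)
Lemma trop_restrict_nbc (alpha : trop_coh R M) : exists c : {set E} -> int,
  trop_restrict R M (ext_proj (\sum_(T | nbc M T) c T *: nbc_form T)) = alpha.
Proof.
have [c cP] := unitriangular_solve (fun S => alpha #|S| (cycle_class #|S| S))
  entry_diag entry_triangular.
exists c; set om := ext_proj _; apply: trop_coh_eq => k z; have [d zE] := tropF_nbc_expansion (valP z).
have -> : z = \sum_(S | nbc M S && (#|S| == k)) cycle_class k S *~ d S.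
  apply: val_inj; rewrite zE raddf_sum; apply: eq_bigr => S /andP[nbcS /eqP <-].
  rewrite -[d S in LHS]intz scaler_int raddfMz; congr (_ *~ _).
  by symmetry; apply: cycle_classE.
rewrite !raddf_sum; apply: eq_bigr => S /andP[nbcS /eqP <-]; rewrite !raddfMz; congr (_ *~ _).
rewrite -cP //= /restrict_form cycle_classE // [LHS]pairing_ext_proj_sum.
by apply: eq_bigr => T _; rewrite pairing_nbc mulrC.
Qed.

Lemma nbc_sum_extW0 (P : pred {set E}) (c : {set E} -> int) :
  \sum_(T | P T) c T *: nbc_form T \in @in_extW0 N.
Proof. by apply: rpred_sum => T _; apply/extW0Z/wedge_gvec_extW0. Qed.

(** Omitting the terms of degree other than [k] from a form that restricts to [alpha]
    keeps the restriction in degree [k] and makes the others zero, as those of [alpha]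
    are. *)
Lemma trop_restrict_nbc_degree k (alpha : trop_coh R M) : trop_deg k alpha ->
  exists2 x : extW0 N, homogeneous k (val x) & trop_restrict R M (ext_proj (val x)) = alpha.
Proof.
move=> deg_alpha; have [c cE] := trop_restrict_nbc alpha.
pose x := \sum_(T | nbc M T && (#|T| == k)) c T *: nbc_form T.
have Wx : x \in @in_extW0 N by apply: nbc_sum_extW0.
exists (exist _ x Wx) => /= [S|].
  apply: contra_neq_eq => neSk; rewrite /x sum_ffunE big1 // => T /andP[_ /eqP Tk].
  rewrite ffunE; case: (eqVneq (nbc_form T S) 0) => [->|]; first exact: mulr0.
  by move=> /wedge_homogeneous; rewrite size_map -cardE Tk => Sk; rewrite Sk eqxx in neSk.
apply: trop_coh_eq => j z; have hz := tropF_homogeneous (valP z).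
case: (eqVneq j k) => [jk|nejk].
  subst j; rewrite -cE /= /restrict_form.
  exact: (esym (pairing_sum_degree (nbc M) c hz)).
rewrite deg_alpha // /= /restrict_form /x [LHS]pairing_ext_proj_sum big1 // => T /andP[_ /eqP Tk].
have neTj : #|T| != j by rewrite Tk eq_sym.
by rewrite (pairing_homogeneous _ hz neTj) ?mulr0 //; apply: homogeneous_nbc_form.
Qed.

Lemma ext_proj_homogeneous k (x : ext (lattW N)) :
  homogeneous k x -> homogeneous k (ext_proj x).
Proof.
move=> hx S; apply: contra_neq_eq => neSk.
have -> : ext_proj x = \sum_T x T *: wedge (map (@proj_form N) (basis_seq T)).
  rewrite {1}(ext_expansion x) raddf_sum; apply: eq_bigr => T _.
  by rewrite -ext_proj_wedge -ext_projZ.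
rewrite sum_ffunE big1 // => T _; rewrite ffunE.
have [xT0|/hx Tk] := eqVneq (x T) 0; first by rewrite xT0; apply: mul0r.
have [->|] := eqVneq ((wedge (map (@proj_form N) (basis_seq T)) : ext (dualV0 N)) S) 0.
  exact: mulr0.
move=> /wedge_homogeneous; rewrite !size_map -cardE Tk => Sk.
by rewrite Sk eqxx in neSk.
Qed.

Definition trop_of_OS (x : OS0 M) : trop_coh R M :=
  trop_restrict R M (ext_proj (val (repr (x : Quotient.quot (OS_ideal0 M))))).

Lemma trop_of_OSE (x : extW0 N) :
  trop_of_OS (OS0_class M x) = trop_restrict R M (ext_proj (val x)).
Proof. by apply: trop_restrict_ideal; apply/rq_classP; rewrite rq_classK. Qed.

Lemma OS0_classK (x : OS0 M) : exists y : extW0 N, x = OS0_class M y.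
Proof. by exists (repr (x : Quotient.quot (OS_ideal0 M))); rewrite /OS0_class rq_classK. Qed.

Lemma trop_of_OS_inj : injective trop_of_OS.
Proof.
move=> x y; have [x' ->] := OS0_classK x; have [y' ->] := OS0_classK y.
by rewrite !trop_of_OSE => /trop_restrict_inj /rq_classP.
Qed.

Lemma trop_of_OS_surj alpha : exists x, trop_of_OS x = alpha.
Proof.
have [c cE] := trop_restrict_nbc alpha.
pose x := \sum_(T | nbc M T) c T *: nbc_form T.
have Wx : x \in @in_extW0 N by apply: nbc_sum_extW0.
by exists (OS0_class M (exist _ x Wx)); rewrite trop_of_OSE.
Qed.

(** Whatever form [trop_lift] chooses is the image of a form of W_0, and this form
    represents the given class because [trop_of_OS] is injective. *)
Lemma trop_of_OSM (x y : OS0 M) :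
  trop_of_OS (x * y) = trop_mul (trop_of_OS x) (trop_of_OS y).
Proof.
have liftE u : exists2 v : extW0 N,
    u = OS0_class M v & trop_lift (trop_of_OS u) = ext_proj (val v).
  have [v' vE] := OS0_classK u.
  have : trop_restrict R M (trop_lift (trop_of_OS u)) = trop_of_OS u.
    apply: (@classical_sets.xgetPex _ 0 (fun om => trop_restrict R M om = _)).
    by exists (ext_proj (val v')); rewrite vE trop_of_OSE.
  have [v <-] := ext_proj_surj (trop_lift (trop_of_OS u)) => vE'.
  exists v; last by [].
  by apply: trop_of_OS_inj; rewrite [RHS]trop_of_OSE; apply: esym.
have [x' xE lx] := liftE x; have [y' yE ly] := liftE y.
have -> : x * y = OS0_class M (x' * y') by rewrite xE yE; apply: esym; apply: rq_classM.
rewrite [LHS]trop_of_OSE; congr (trop_restrict R M _).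
exact: (etrans (ext_projM (val x') (val y')) (esym (congr2 *%R lx ly))).
Qed.

Lemma trop_of_OS_deg k (x : OS0 M) : OS0_deg k x <-> trop_deg k (trop_of_OS x).
Proof.
split=> [[y hy ->] j nejk z|/trop_restrict_nbc_degree[y hy yE]].
  rewrite trop_of_OSE /= /restrict_form.
  apply: (pairing_homogeneous (ext_proj_homogeneous hy) (tropF_homogeneous (valP z))).
  by rewrite eq_sym.
exists y; first exact: hy.
by apply: trop_of_OS_inj; rewrite [RHS]trop_of_OSE; apply: esym.
Qed.
End Isomorphism.

Theorem theorem4 (R : realType) (N n : nat) (M : matroid 'I_N.+1)
    (loopless_M : loopless M) (rank_M : mrank M [set: 'I_N.+1] = n) :
  exists phi : OS0 M -> trop_coh R M,
    [/\ bijective phi,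
        forall x y : OS0 M, phi (x + y) = trop_add (phi x) (phi y),
        phi 1 = trop_one R M /\
          (forall x y : OS0 M, phi (x * y) = trop_mul (phi x) (phi y)),
        forall (k : nat) (x : OS0 M), OS0_deg k x <-> trop_deg k (phi x) &
        forall ws : seq (lattW0 N),
          phi (OS0_class M (wedgeW0 ws)) =
          trop_restrict R M (wedge [seq dualW0 w | w <- ws])].
Proof.
exists (@trop_of_OS R N M); split.
- have [psi psiK] := @choice _ (OS0 M) (fun alpha x => trop_of_OS R x = alpha)
    (trop_of_OS_surj loopless_M).
  exists psi => [x|]; last exact: psiK.
  exact: (trop_of_OS_inj loopless_M (psiK _)).
- move=> x y; have [x' ->] := OS0_classK x; have [y' ->] := OS0_classK y.
  rewrite -[_ + _](raddfD (OS0_class M)) !trop_of_OSE //; apply: trop_coh_eq => k z.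
  by rewrite /= /restrict_form !raddfD pairingDl.
- split; last exact: trop_of_OSM.
  rewrite -[1](rmorph1 (OS0_class M)) trop_of_OSE //; apply: trop_coh_eq => k z.
  by rewrite rmorph1 ext_proj1.
- exact: trop_of_OS_deg.
by move=> ws; rewrite trop_of_OSE // ext_proj_wedgeW0.
Qed.
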